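(* Let $b$ be a locally finite, connected graph over $(X,m)$, $q:X\to\mathbb{R}$, let the associated form $h$ be bounded from below on $\ell^2(X,m)$, and let $d$ be an intrinsic metric. Let $\lambda\in\mathbb{R}$ and $w:X\to[0,\infty)$ be such that $h-\lambda\ge w$ on $C_c(X\setminus K)$ for some finite set $K\subseteq X$. Let $u$ be either (a) an approximable function $u\in\mathcal{F}$ that satisfies $(\mathcal{H}-\lambda)u=0$ on $X\setminus K$, or that satisfies $u\ge0$ and $(\mathcal{H}-\lambda)u\le0$ on $X\setminus K$, or (b) a function $u\in D(H)$ with $(\mathcal{H}-\lambda)u=0$ on $X\setminus K$, where in this case $q\in V$ is assumed. Let $\rho=\rho_{d,w}(o,\cdot)$ for some fixed $o\in X$, where $$\rho_{d,w}(x,y)=\inf_{x=x_0\sim\ldots\sim x_n=y}\sum_{i=0}^{n-1}\min\Big\{1,\ \big(w(x_i)\wedge w(x_{i+1})\big)^{1/2}d(x_i,x_{i+1})\Big\}.$$ Then there is $r>0$ such that $$u\in\ell^2(X,e^{r\rho}wm).$$ Specifically, one can choose any $r>0$ such that $r^2\left(\frac{1+e^r}{16}\right)<1$.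
   Context: $X$ is an infinite countable set, $m:X\to(0,\infty)$, and a graph $b$ over $(X,m)$ is a symmetric function $b:X\times X\to[0,\infty)$ with zero diagonal and $\sum_{y}b(x,y)<\infty$ for all $x$; $x\sim y$ means $b(x,y)>0$; the graph is locally finite if $\#\{y:y\sim x\}<\infty$ for all $x$. $C(X)$ is the space of real functions on $X$, $C_c(X)$ those with finite support, and for $W\subseteq X$, $C_c(W)$ consists of those $\varphi\in C_c(X)$ vanishing outside $W$. For $f\in C(X)$, $|\nabla f|^2(x)=\frac{1}{2m(x)}\sum_{y}b(x,y)(f(x)-f(y))^2$. For $q:X\to\mathbb{R}$, $h(\varphi)=h_{b,q}(\varphi)=\sum_{X}(|\nabla\varphi|^2+q\varphi^2)m$ for $\varphi\in C_c(X)$. ''$h-\lambda\ge w$ on $C_c(W)$'' means $h(\varphi)-\lambda\sum_X\varphi^2m\ge\sum_X w\varphi^2m$ for all $\varphi\in C_c(W)$. $h$ bounded from below on $\ell^2(X,m)$ means $h(\varphi)\ge -C\sum_X\varphi^2m$ on $C_c(X)$ for some $C$; then $h$ is closable, its closure is again denoted $h$ with domain $D(h)$, and $H$ is the associated self-adjoint operator with domain $D(H)$. $H$ is a restriction of the formal operator $\mathcal{H}f(x)=\frac1{m(x)}\sum_y b(x,y)(f(x)-f(y))+q(x)f(x)$, defined on $\mathcal{F}=\{f\in C(X):\sum_y b(x,y)|f(y)|<\infty\ \forall x\in X\}$. $V$ is the set of $q\in C(X)$, $q=q_+-q_-$ (positive and negative parts), such that for some $\varepsilon>0,C>0$: $\sum_X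 q_-\varphi^2m\le(1-\varepsilon)h_{b,q_+}(\varphi)+C\sum_X\varphi^2m$ for all $\varphi\in C_c(X)$. A function $u\in\mathcal{F}$ is approximable if there is a sequence $(\varphi_n)$ in $C_c(X)$ with $0\le\varphi_n\nearrow1$ pointwise and $\lim_{n\to\infty}\sum_Xu^2|\nabla\varphi_n|^2m=0$. An intrinsic metric is a pseudo-metric $d:X\times X\to[0,\infty)$ (symmetric, zero on the diagonal, triangle inequality) with $\sum_yb(x,y)d(x,y)^2\le m(x)$ for all $x\in X$. For a weight $\mu\ge0$, $u\in\ell^2(X,\mu)$ means $\sum_Xu^2\mu<\infty$. *)

(* Defs.v *)
From HB Require Import structures.
From mathcomp Require Import all_boot all_order all_algebra.
From mathcomp Require Import all_classical all_reals all_analysis.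
Import Order.TTheory GRing.Theory Num.Theory.
Import numFieldNormedType.Exports.

Set Implicit Arguments.
Unset Strict Implicit.
Unset Printing Implicit Defensive.

Local Open Scope classical_set_scope.
Local Open Scope ring_scope.

Section Sums.
Context {R : realType} {X : choiceType}.

(* Real value of an absolutely convergent sum of a signed family; [fine] gives a
   junk value only when the family is not summable. *)
Definition rsum (f : X -> R) : R :=
  fine (\esum_(x in [set: X]) (f^\+ x)%:E) -
  fine (\esum_(x in [set: X]) (f^\- x)%:E).

Definition ell2 (mu : X -> R) (u : X -> R) : Prop :=
  (\esum_(x in [set: X]) (u x ^+ 2 * mu x)%:E < +oo)%E.

Definition Cc (W : set X) : set (X -> R) :=
  [set phi | finite_set [set x | phi x != 0] /\
             forall x, ~ W x -> phi x = 0].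

End Sums.

Section Graphs.
Context {R : realType} {X : choiceType}.
Implicit Types (m w : X -> R) (b d : X -> X -> R).

Definition is_graph b : Prop :=
  [/\ forall x y, 0 <= b x y,
      forall x y, b x y = b y x,
      forall x, b x x = 0 &
      forall x, (\esum_(y in [set: X]) (b x y)%:E < +oo)%E].

Definition adj b : rel X := [rel x y | 0 < b x y].

Definition locally_finite b : Prop :=
  forall x, finite_set [set y | adj b x y].

(* [x :: p] is the path x = x_0 ~ ... ~ x_n = y with n = size p (n = 0 is
   allowed). *)
Definition is_path b (x y : X) (p : seq X) : Prop :=
  path (adj b) x p /\ last x p = y.

Definition graph_connected b : Prop :=
  forall x y, exists p, is_path b x y p.

Definition is_intrinsic_metric m b d : Prop :=
  [/\ [/\ forall x y, 0 <= d x y,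
          forall x, d x x = 0,
          forall x y, d x y = d y x &
          forall x y z, d x z <= d x y + d y z] &
      forall x,
        (\esum_(y in [set: X]) (b x y * d x y ^+ 2)%:E <= (m x)%:E)%E].

Definition rho_length d w (x y : X) : R :=
  Num.min 1 (Num.sqrt (Num.min (w x) (w y)) * d x y).

Definition rho b d w (x y : X) : R :=
  inf [set l | exists2 p, is_path b x y p &
    l = \sum_(i < size p) rho_length d w (nth x (x :: p) i)
                                         (nth x (x :: p) i.+1)].

End Graphs.

Section Forms.
Context {R : realType} {X : choiceType}.
Variables (m : X -> R) (b : X -> X -> R).
Implicit Types (q w u v f : X -> R).

(* |\nabla f|^2 *)
Definition grad2 f (x : X) : R :=
  (2 * m x)^-1 * rsum (fun y => b x y * (f x - f y) ^+ 2).

(* \sum_X (|\nabla phi|^2 + q phi^2) m *)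
Definition hform q (phi : X -> R) : R :=
  rsum (fun x => (grad2 phi x + q x * phi x ^+ 2) * m x).

(* h - lambda >= w on C_c(W) *)
Definition form_ge q (lambda : R) w (W : set X) : Prop :=
  forall phi : X -> R, Cc W phi ->
    hform q phi - lambda * rsum (fun x => phi x ^+ 2 * m x)
      >= rsum (fun x => w x * phi x ^+ 2 * m x).

Definition bounded_from_below q : Prop :=
  exists C : R, forall phi : X -> R, Cc [set: X] phi ->
    hform q phi >= - C * rsum (fun x => phi x ^+ 2 * m x).

Definition formal_domain : set (X -> R) :=
  [set f | forall x, (\esum_(y in [set: X]) (b x y * `|f y|)%:E < +oo)%E].

Definition formalH q f (x : X) : R :=
  (m x)^-1 * rsum (fun y => b x y * (f x - f y)) + q x * f x.

Definition classV : set (X -> R) :=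
  [set q | exists eps C : R, [/\ 0 < eps, 0 < C &
    forall phi : X -> R, Cc [set: X] phi ->
      rsum (fun x => q^\- x * phi x ^+ 2 * m x) <=
        (1 - eps) * hform q^\+ phi + C * rsum (fun x => phi x ^+ 2 * m x)]].

Definition approximable : set (X -> R) :=
  [set u | formal_domain u /\
    exists phi : nat -> X -> R,
      [/\ forall n, Cc [set: X] (phi n),
          forall n x, 0 <= phi n x <= phi n.+1 x,
          forall x, phi n x @[n --> \oo] --> (1 : R) &
          (\esum_(x in [set: X]) (u x ^+ 2 * grad2 (phi n) x * m x)%:E)
            @[n --> \oo] --> (0 : \bar R)%E]].

(* phi_n -> u in l^2(X, m) and (phi_n) is h-Cauchy.  Given the l^2-convergence
   and the lower bound on h, this is the Cauchy property for the form norm. *)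
Definition h_approximates q (phi : nat -> X -> R) u : Prop :=
  [/\ forall n, Cc [set: X] (phi n),
      (\esum_(x in [set: X]) ((phi n x - u x) ^+ 2 * m x)%:E)
        @[n --> \oo] --> (0 : \bar R)%E &
      forall eps : R, 0 < eps -> exists N, forall i j,
        (N <= i)%N -> (N <= j)%N -> `|hform q (phi i \- phi j)| < eps].

(* D(h) for the closure of h *)
Definition form_domain q : set (X -> R) :=
  [set u | exists phi, h_approximates q phi u].

(* The closure of h on D(h): h(u) = lim_n h(phi_n).  The value does not depend
   on (phi_n) because h is closable. *)
Definition closed_form q u : R :=
  xget 0 [set c | exists2 phi, h_approximates q phi u &
                               hform q (phi n) @[n --> \oo] --> c].

Definition closed_bilin q u v : R :=
  4^-1 * (closed_form q (u \+ v) - closed_form q (u \- v)).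

(* D(H) for the self-adjoint operator H associated with the closed form: the
   function g is H u. *)
Definition operator_domain q : set (X -> R) :=
  [set u | form_domain q u /\
    exists2 g, ell2 m g &
      forall v, form_domain q v ->
        closed_bilin q u v = rsum (fun x => g x * v x * m x)].

End Forms.

(* Main.v *)
Require Import Defs.
From HB Require Import structures.
From mathcomp Require Import all_boot all_order all_algebra.
From mathcomp Require Import all_classical all_reals all_analysis.
From mathcomp Require Import ring lra.
Import Order.TTheory GRing.Theory Num.Theory.
Import numFieldNormedType.Exports.

Set Implicit Arguments.
Unset Strict Implicit.
Unset Printing Implicit Defensive.

Local Open Scope classical_set_scope.
Local Open Scope ring_scope.

(* For finitely supported psi vanishing on K, the ground state identity
   h(u psi) - lambda |u psi|^2 = <(H - lambda) u, u psi^2>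
     + 1/2 sum_{x,y} b(x,y) u(x) u(y) (psi(x) - psi(y))^2
   turns h - lambda >= w into a bound of sum w u^2 psi^2 m by the last sum.
   For psi = g = exp(r rho / 2), |rho(x) - rho(y)| <= min(1, sqrt(w(x)) d(x,y))
   and (e^s - e^t)^2 <= (s - t)^2 (e^{2s} + e^{2t}) / 2 bound that sum by
   r^2 (1 + e^r) / 16 times sum w u^2 g^2 m, which is absorbed.  So rho is
   truncated at M, psi is multiplied by the indicator of X \ K, and the only
   terms left over come from the edges meeting K; they are finite and do not
   depend on M.  Compact support is obtained in case (a) by multiplying psi by
   the cutoffs phi_n, whose gradient terms vanish in the limit.  In case (b),
   which only uses that u lies in the form domain, u is replaced by form
   approximants f_n in C_c(X), and <(H - lambda) f_n, f_n g^2 1_{X \ K}> tends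
   to 0 since the second argument stays bounded in the form norm; this
   boundedness is where q in V enters. *)

(** * Sums of finitely supported functions as sums over lists *)

Section FiniteSums.
Context {R : realType} {X : choiceType}.
Implicit Types (f g : X -> R) (s t : seq X).

Definition supp_in s f := forall x, x \notin s -> f x = 0.

Lemma finite_set_seq (A : set X) :
  finite_set A -> exists2 s, uniq s & forall x, A x <-> x \in s.
Proof.
move=> /finite_seqP[s ->]; exists (undup s); first exact: undup_uniq.
by move=> x; rewrite mem_undup.
Qed.

Lemma esum_supp s (f : X -> \bar R) : uniq s -> (forall x, 0 <= f x)%E ->
  (forall x, x \notin s -> f x = 0)%E ->
  (\esum_(x in [set: X]) f x = \sum_(x <- s) f x)%E.
Proof.
move=> us f0 sf; transitivity (\esum_(x in [set` s]) f x)%E.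
  rewrite [RHS]esum_mkcond; apply: eq_esum => x _.
  rewrite mem_setE; case: ifPn => [//|xs]; rewrite sf//.
by rewrite esum_fset -?fsbig_seq//; exact: finite_seq.
Qed.

Lemma rsum_supp s f : uniq s -> supp_in s f -> rsum f = \sum_(x <- s) f x.
Proof.
move=> us sf; rewrite /rsum !(@esum_supp s)//.
- rewrite !sumEFin/= -sumrB; apply: eq_bigr => x _.
  by rewrite -[in RHS](funrposBneg f).
- by move=> x; rewrite lee_fin funrneg_ge0.
- by move=> x /sf fx; rewrite /funrneg fx oppr0 maxxx.
- by move=> x; rewrite lee_fin funrpos_ge0.
- by move=> x /sf fx; rewrite /funrpos fx maxxx.
Qed.

Lemma sum_le_esum s f : uniq s -> (forall x, 0 <= f x) ->
  ((\sum_(x <- s) f x)%:E <= \esum_(x in [set: X]) (f x)%:E)%E.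
Proof.
move=> us f0; apply: esum_ge; exists [set` s]; first by split=> //; exact: finite_seq.
by rewrite -fsbig_seq// sumEFin.
Qed.

Lemma esum_lty f (B : R) : (forall s, uniq s -> \sum_(x <- s) f x <= B) ->
  (\esum_(x in [set: X]) (f x)%:E < +oo)%E.
Proof.
move=> fB; apply: (@le_lt_trans _ _ B%:E); last exact: ltry.
apply: ge_ereal_sup => _ [A [finA _] <-].
by rewrite fsbig_finite//= sumEFin lee_fin fB.
Qed.

Lemma sum_supp s t f : uniq s -> uniq t -> {subset s <= t} ->
  supp_in s f -> \sum_(x <- t) f x = \sum_(x <- s) f x.
Proof.
move=> us ut st sf; rewrite -(@rsum_supp s)// -(@rsum_supp t)// => x xt.
by apply: sf; apply: contra xt => /st.
Qed.

Lemma sum_le_supp s t f : uniq s -> uniq t -> (forall x, 0 <= f x) ->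
  supp_in t f -> \sum_(x <- s) f x <= \sum_(x <- t) f x.
Proof.
move=> us ut f0 tf; rewrite -lee_fin (le_trans (sum_le_esum us f0))//.
by rewrite (@esum_supp t) ?sumEFin// => x /tf ->.
Qed.

End FiniteSums.

(** * An inequality for differences of exponentials *)

Section Elementary.
Context {R : realType}.
Implicit Types (a b t : R).

(** Equivalent to tanh(t/2) <= t/2. Right side minus left side vanishes at 0 and has derivative
    [expR s * (expR (- s) - (1 - s)) / 2], which is nonnegative. *)
Lemma expRB1_le t : 0 <= t -> expR t - 1 <= t / 2 * (expR t + 1).
Proof.
move=> t0; rewrite -subr_ge0.
pose F (s : R) : R := s / 2 * (expR s + 1) - (expR s - 1).
pose dF (s : R) : R := 2^-1 * (expR s + 1) + s / 2 * expR s - expR s.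
have drv (s : R) : is_derive s 1 F (dF s).
  rewrite /F; apply: is_derive_eq; rewrite /dF /GRing.scale/=; ring.
have cF : {within `[0, t], continuous F}.
  by apply: derivable_within_continuous => s _; case: (drv s).
have [c c0t] := MVT_segment t0 (fun s _ => drv s) cF.
have -> : F 0 = 0 by rewrite /F expR0; ring.
rewrite !subr0 -/(F t) => ->; rewrite mulr_ge0// /dF.
have -> : 2^-1 * (expR c + 1) + c / 2 * expR c - expR c =
  2^-1 * (expR c * (expR (- c) - (1 - c))).
  by rewrite !mulrBr expRxMexpNx_1; field.
rewrite mulr_ge0 ?invr_ge0// mulr_ge0 ?expR_ge0// subr_ge0.
exact: expR_ge1Dx.
Qed.

(** Factor out [expR b ^+ 2], apply [expRB1_le] at a - b >= 0 and use (z + 1)^2 <= 2 (z^2 + 1). The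
    mean of the two squares on the right is the origin of 1 + e^r in the final constant. *)
Lemma expRB_sqr_le a b :
  (expR a - expR b) ^+ 2 <= (a - b) ^+ 2 * ((expR a ^+ 2 + expR b ^+ 2) / 2).
Proof.
wlog ab : a b / b <= a.
  move=> H; have [/H//|/ltW/H] := leP b a.
  by rewrite -(opprB (expR a)) -(opprB a) !sqrrN (addrC (expR b ^+ 2)).
have t0 : 0 <= a - b by rewrite subr_ge0.
have := expRB1_le t0.
have -> : expR a = expR b * expR (a - b) by rewrite -expRD addrC subrK.
have b0 := expR_gt0 b; have e1 : 1 <= expR (a - b) by rewrite -expR0 ler_expR.
set z := expR (a - b) in e1 *; set t := a - b in t0 *; set y := expR b in b0 *.
move=> H.
have H2 : (z - 1) ^+ 2 <= (t / 2 * (z + 1)) ^+ 2.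
  by rewrite lerXn2r// nnegrE; nra.
have H3 : (t / 2 * (z + 1)) ^+ 2 <= t ^+ 2 * ((z ^+ 2 + 1) / 2).
  have : 0 <= t ^+ 2 * (z - 1) ^+ 2 by rewrite mulr_ge0 ?sqr_ge0.
  by nra.
have -> : (y * z - y) ^+ 2 = y ^+ 2 * (z - 1) ^+ 2 by ring.
have -> : t ^+ 2 * (((y * z) ^+ 2 + y ^+ 2) / 2) =
  y ^+ 2 * (t ^+ 2 * ((z ^+ 2 + 1) / 2)) by ring.
by rewrite ler_wpM2l ?sqr_ge0// (le_trans H2).
Qed.

End Elementary.

(** * The form on finite vertex lists: Green's formula and the ground state identity *)

Section FiniteForms.
Context {R : realType} {X : choiceType}.
Variables (m : X -> R) (b : X -> X -> R).
Hypothesis m_gt0 : forall x, 0 < m x.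
Hypothesis b_graph : is_graph b.
Implicit Types (f g v psi q w : X -> R) (s t : seq X).

Let b_ge0 x y : 0 <= b x y. Proof. by case: b_graph. Qed.
Let b_sym x y : b x y = b y x. Proof. by case: b_graph. Qed.

(** For a function supported in [s0], every edge along which it changes lies inside [s], so its form
    is a double sum over [s]. Enlarging [s] preserves this, which lets several functions share one
    list. *)
Definition hull s0 s :=
  [/\ uniq s, {subset s0 <= s} & forall x y, x \in s0 -> adj b x y -> y \in s].

Definition energy s f g : R :=
  2^-1 * \sum_(x <- s) \sum_(y <- s) b x y * ((f x - f y) * (g x - g y)).

Definition hfin q s f g : R := energy s f g + \sum_(x <- s) q x * f x * g x * m x.

Lemma hull_exists s0 : locally_finite b -> exists s, hull s0 s.
Proof.
move=> lf; have [s us sE] : exists2 s, uniq s &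
    forall y, (exists2 x, x \in s0 & adj b x y) <-> y \in s.
  apply: finite_set_seq.
  have -> : (fun y => exists2 x, x \in s0 & adj b x y) =
      \bigcup_(x in [set` s0]) [set y | adj b x y].
    by apply/seteqP; split=> y [x xs xy]; exists x.
  by apply: bigcup_finite => [|x _]; [exact: finite_seq|exact: lf].
exists (undup (s0 ++ s)); split; first exact: undup_uniq.
- by move=> x xs; rewrite mem_undup mem_cat xs.
- move=> x y xs xy; rewrite mem_undup mem_cat; apply/orP; right.
  by apply/sE; exists x.
Qed.

Lemma hull_sub s0 s t0 s' : hull s0 s -> uniq s' -> {subset t0 <= s0} ->
  {subset s <= s'} -> hull t0 s'.
Proof.
move=> [us s0s nb] us' t0s0 ss'; split=> //; first by move=> x /t0s0/s0s/ss'.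
by move=> x y /t0s0 xs xy; apply/ss'/(nb x).
Qed.

Lemma notin_hull s0 s x y : hull s0 s -> x \in s0 -> y \notin s -> b x y = 0.
Proof.
move=> [_ _ nb] xs; apply: contraNeq => bxy.
by apply: (nb x) => //; rewrite /adj/= lt_neqAle eq_sym bxy b_ge0.
Qed.

Lemma rsum_nbr s0 s f x : hull s0 s -> x \in s0 ->
  rsum (fun y => b x y * f y) = \sum_(y <- s) b x y * f y.
Proof.
move=> hs xs; apply: rsum_supp; first by case: hs.
by move=> y /(notin_hull hs xs) ->; rewrite mul0r.
Qed.

Lemma grad2_mul f x :
  grad2 m b f x * m x = 2^-1 * rsum (fun y => b x y * (f x - f y) ^+ 2).
Proof.
rewrite /grad2; have := m_gt0 x; set S := rsum _ => mx.
by field; rewrite gt_eqF.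
Qed.

Lemma sum_grad2_le s f x : locally_finite b -> uniq s ->
  2^-1 * \sum_(y <- s) b x y * (f x - f y) ^+ 2 <= grad2 m b f x * m x.
Proof.
move=> lf us; rewrite grad2_mul ler_pM2l ?invr_gt0//.
have [t ht] := hull_exists [:: x] lf.
rewrite (rsum_nbr (fun y => (f x - f y) ^+ 2) ht) ?mem_head//.
apply: sum_le_supp => //; first by case: ht.
- by move=> y; rewrite mulr_ge0 ?sqr_ge0.
- by move=> y /(notin_hull ht (mem_head x [::])) ->; rewrite mul0r.
Qed.

(** A vertex outside [s] has no neighbour in [s0], so its gradient term vanishes. At a vertex of [s]
    outside [s0], [f] vanishes there and off [s], so the inner sum reduces to [s] as well. *)
Lemma hformE q s0 s f : hull s0 s -> supp_in s0 f ->
  hform m b q f = hfin q s f f.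
Proof.
move=> hs sf; have [us s0s _] := hs.
have fs x : x \notin s -> f x = 0 by move=> xs; apply: sf; apply: contra xs => /s0s.
have gradE x : x \in s -> rsum (fun y => b x y * (f x - f y) ^+ 2) =
    \sum_(y <- s) b x y * (f x - f y) ^+ 2.
  move=> xs; have [xs0|xs0] := boolP (x \in s0).
    exact: (rsum_nbr (fun y => (f x - f y) ^+ 2) hs).
  apply: rsum_supp => // y ys.
  by rewrite (sf _ xs0) (fs _ ys) subrr expr0n mulr0.
rewrite /hform (rsum_supp us); last first.
  move=> x xs; rewrite mulrDl grad2_mul.
  have -> : rsum (fun y => b x y * (f x - f y) ^+ 2) = 0.
    rewrite (rsum_supp us); last by move=> y ys; rewrite !fs// subrr expr0n mulr0.
    rewrite big_seq big1// => y ys; have [ys0|/sf ->] := boolP (y \in s0).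
      by rewrite b_sym (notin_hull hs ys0 xs) mul0r.
    by rewrite (fs _ xs) subrr expr0n mulr0.
  by rewrite (fs x xs); ring.
rewrite /hfin /energy mulr_sumr -big_split/= big_seq [RHS]big_seq.
apply: eq_bigr => x xs; rewrite mulrDl grad2_mul gradE//; congr (_ + _); ring.
Qed.

Lemma sum2_exchange s (F : X -> X -> R) :
  \sum_(x <- s) \sum_(y <- s) F x y = \sum_(x <- s) \sum_(y <- s) F y x.
Proof. by rewrite exchange_big. Qed.

(** Expand [v x - v y] and swap x and y in one half; symmetry of [b] makes the halves equal. Only
    [v] needs finite support, so [f] may be the solution [u] itself. *)
Lemma green q s0 s f v : hull s0 s -> supp_in s0 v ->
  hfin q s f v = \sum_(x <- s) v x * formalH m b q f x * m x.
Proof.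
move=> hs sv; have -> : hfin q s f v =
    \sum_(x <- s) (v x * (\sum_(y <- s) b x y * (f x - f y)) + q x * f x * v x * m x).
  rewrite /hfin big_split/=; congr (_ + _).
  have -> : energy s f v = 2^-1 * (\sum_(x <- s) \sum_(y <- s) b x y * ((f x - f y) * v x)
      - \sum_(x <- s) \sum_(y <- s) b x y * ((f x - f y) * v y)).
    rewrite /energy -sumrB; congr (_ * _); apply: eq_bigr => x _.
    by rewrite -sumrB; apply: eq_bigr => y _; ring.
  rewrite [X in _ - X]sum2_exchange.
  have -> : \sum_(x <- s) \sum_(y <- s) b y x * ((f y - f x) * v x) =
      - \sum_(x <- s) \sum_(y <- s) b x y * ((f x - f y) * v x).
    rewrite -sumrN; apply: eq_bigr => x _; rewrite -sumrN.
    by apply: eq_bigr => y _; rewrite (b_sym y x); ring.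
  rewrite opprK -mulr2n -[X in _ * X]mulr_natl mulKf ?pnatr_eq0//.
  apply: eq_bigr => x _; rewrite mulr_sumr.
  by apply: eq_bigr => y _; ring.
apply: eq_bigr => x _.
have [xs0|/sv ->] := boolP (x \in s0); last by rewrite !mul0r mulr0 mul0r addr0.
rewrite /formalH (rsum_nbr (fun y => f x - f y) hs xs0).
by have := m_gt0 x; set S := \sum_(_ <- _) _ => mx; field; rewrite gt_eqF.
Qed.

(** Holds edge by edge as a polynomial identity: (f x psi x - f y psi y)^2 equals (f x - f y) (f x
    psi x^2 - f y psi y^2) + f x f y (psi x - psi y)^2. *)
Lemma hfin_ground_state q s f psi :
  hfin q s (f \* psi) (f \* psi) = hfin q s f (fun x => f x * psi x ^+ 2) +
    2^-1 * \sum_(x <- s) \sum_(y <- s) b x y * (f x * f y * (psi x - psi y) ^+ 2).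
Proof.
rewrite /hfin /energy addrAC; congr (_ + _); last by apply: eq_bigr => x _ /=; ring.
rewrite -mulrDr -big_split/=; congr (_ * _); apply: eq_bigr => x _.
by rewrite -big_split/=; apply: eq_bigr => y _; ring.
Qed.

(** Bound f x f y by the mean of the two squares; both squares contribute the same sum because [b]
    and [D] are symmetric. *)
Lemma sum_cross_le s f (D : X -> X -> R) :
  (forall x y, 0 <= D x y) -> (forall x y, D x y = D y x) ->
  \sum_(x <- s) \sum_(y <- s) b x y * (f x * f y * D x y) <=
  \sum_(x <- s) \sum_(y <- s) b x y * (f x ^+ 2 * D x y).
Proof.
move=> D0 Dsym; set S := leRHS.
have SE : S = 2^-1 * (S + \sum_(x <- s) \sum_(y <- s) b x y * (f y ^+ 2 * D x y)).
  rewrite [X in _ + X](_ : _ = S); last first.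
    rewrite sum2_exchange; apply: eq_bigr => x _; apply: eq_bigr => y _.
    by rewrite b_sym Dsym.
  by rewrite -mulr2n -[X in _ * X]mulr_natl mulKf ?pnatr_eq0.
rewrite SE /S -big_split/= mulr_sumr; apply: ler_sum => x _.
rewrite -big_split/= mulr_sumr; apply: ler_sum => y _.
rewrite -subr_ge0 (_ : _ - _ = 2^-1 * (b x y * D x y * (f x - f y) ^+ 2)); last by field.
by rewrite mulr_ge0 ?invr_ge0// mulr_ge0 ?sqr_ge0// mulr_ge0.
Qed.

End FiniteForms.

(** * Limits of finite sums and of total sums tending to 0 *)

Section Limits.
Context {R : realType}.

Lemma cvg_sum_seq (T : Type) (s : seq T) (F : nat -> T -> R) (l : T -> R) :
  (forall x, F n x @[n --> \oo] --> l x) ->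
  \sum_(x <- s) F n x @[n --> \oo] --> \sum_(x <- s) l x.
Proof.
move=> Fl; elim: s => [|x s IHs].
  by under eq_cvg do rewrite big_nil; rewrite big_nil; exact: cvg_cst.
by under eq_cvg do rewrite big_cons; rewrite big_cons; exact: cvgD.
Qed.

Lemma cvgn_le0 (A : nat -> R) (a : R) : A n @[n --> \oo] --> a ->
  (forall d : R, 0 < d -> exists N, forall n, (N <= n)%N -> A n <= d) -> a <= 0.
Proof.
move=> Aa H; apply/ler_addgt0Pr => d d0; rewrite add0r.
have [N HN] := H d d0.
apply: (cvgr_to_le Aa); near=> n; apply: HN; near: n; exact: nbhs_infty_ge.
Unshelve. all: by end_near. Qed.

(** Turns vanishing total sums into a bound on finite partial sums that is uniform in the list,
    which is the form in which cutoffs and approximants enter the estimates. *)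
Lemma esum_cvg0 (X : choiceType) (F : nat -> X -> R) : (forall n x, 0 <= F n x) ->
  (\esum_(x in [set: X]) (F n x)%:E)%E @[n --> \oo] --> (0 : \bar R)%E ->
  forall e : R, 0 < e -> exists N, forall n s, (N <= n)%N -> uniq s ->
    \sum_(x <- s) F n x <= e.
Proof.
move=> F0 /fine_cvgP[[N1 _ fin1] /cvgrPdist_lt cv] e e0.
have [N2 _ lt2] := cv e e0.
exists (maxn N1 N2) => n s; rewrite geq_max => /andP[n1 n2] us.
have := lt2 n n2; rewrite /= sub0r normrN => lte.
rewrite -lee_fin (le_trans (sum_le_esum us (F0 n)))//.
rewrite -(fineK (fin1 n n1)) lee_fin ltW//.
exact: le_lt_trans (ler_norm _) lte.
Qed.

End Limits.

(** * Estimates along a single edge for weights cut off at K *)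

Section Cutoff.
Context {R : realFieldType}.

(** If both endpoints are off K, write the difference as px (gx - gy) + gy (px - py) and apply
    Young's inequality with weight e. Otherwise at most one term survives, and the last summand
    dominates it. *)
Lemma cutoff_le (e M gx gy Gx Gy px py : R) (kx ky : bool) : 0 < e ->
  0 <= gx <= M -> 0 <= gy <= M -> gx <= Gx -> gy <= Gy ->
  0 <= px <= 1 -> 0 <= py <= 1 ->
  (px * gx * kx%:R - py * gy * ky%:R) ^+ 2 <=
  (1 + e) * (kx%:R * px ^+ 2 * (gx - gy) ^+ 2) +
  (1 + e^-1) * M ^+ 2 * (px - py) ^+ 2 +
  (1 - kx%:R * ky%:R) * (Gx ^+ 2 + Gy ^+ 2).
Proof.
move=> e0 /andP[gx0 gxM] /andP[gy0 gyM] gG gG' /andP[px0 px1] /andP[py0 py1].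
have ei0 : 0 < e^-1 by rewrite invr_gt0.
have ee : e * e^-1 = 1 by rewrite mulfV// gt_eqF.
have D2 : 0 <= (px - py) ^+ 2 by exact: sqr_ge0.
have M2 : gy ^+ 2 <= M ^+ 2 by rewrite lerXn2r ?nnegrE ?(le_trans gy0).
have A0 : 0 <= (1 + e^-1) * M ^+ 2 * (px - py) ^+ 2.
  by apply: mulr_ge0 => //; apply: mulr_ge0; [lra|exact: sqr_ge0].
have B0 : 0 <= (1 + e) * (px ^+ 2 * (gx - gy) ^+ 2).
  by apply: mulr_ge0; [lra|apply: mulr_ge0; exact: sqr_ge0].
have Hx : (px * gx) ^+ 2 <= Gx ^+ 2.
  have pg0 : 0 <= px * gx by exact: mulr_ge0.
  have pgG : px * gx <= Gx by apply: le_trans gG; exact: ler_piMl.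
  by rewrite lerXn2r// nnegrE// (le_trans pg0).
have Hy : (py * gy) ^+ 2 <= Gy ^+ 2.
  have pg0 : 0 <= py * gy by exact: mulr_ge0.
  have pgG : py * gy <= Gy by apply: le_trans gG'; exact: ler_piMl.
  by rewrite lerXn2r// nnegrE// (le_trans pg0).
have Gx2 := sqr_ge0 Gx; have Gy2 := sqr_ge0 Gy.
case: kx ky => -[]; rewrite ?mulr1n ?mulr0n ?mulr1 ?mulr0 ?mul0r ?mul1r
  ?subr0 ?sub0r ?subrr ?addr0 ?add0r ?mul0r ?sqrrN //.
- set A := px * (gx - gy); set B := gy * (px - py).
  have -> : px * gx - py * gy = A + B by rewrite /A /B; ring.
  have AB : (A + B) ^+ 2 <= (1 + e) * A ^+ 2 + (1 + e^-1) * B ^+ 2.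
    rewrite -subr_ge0 (_ : _ - _ = e^-1 * (e * A - B) ^+ 2).
      by rewrite mulr_ge0 ?sqr_ge0// ltW.
    by field; rewrite gt_eqF.
  rewrite addr0 (le_trans AB)// /A exprMn lerD2l// -mulrA ler_pM2l; last lra.
  by rewrite /B exprMn ler_wpM2r.
- by lra.
- by lra.
- by rewrite expr0n/=; lra.
Qed.

(** Off K, factor gx^2 - gy^2 and bound gx + gy by 2 M. If the edge meets K, a surviving g^4 is at
    most M^2 G^2. *)
Lemma cutoff_sq_le (M gx gy Gx Gy : R) (kx ky : bool) :
  0 <= gx <= M -> 0 <= gy <= M -> gx <= Gx -> gy <= Gy ->
  (gx ^+ 2 * kx%:R - gy ^+ 2 * ky%:R) ^+ 2 <=
  4 * M ^+ 2 * (kx%:R * (gx - gy) ^+ 2) +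
  M ^+ 2 * ((1 - kx%:R * ky%:R) * (Gx ^+ 2 + Gy ^+ 2)).
Proof.
move=> /andP[gx0 gxM] /andP[gy0 gyM] gG gG'.
have M0 : 0 <= M by rewrite (le_trans gx0).
have M2 := sqr_ge0 M; have g2 := sqr_ge0 (gx - gy).
have A0 : 0 <= M ^+ 2 * (gx - gy) ^+ 2 by rewrite mulr_ge0.
have H1 (g G : R) : 0 <= g -> g <= M -> g <= G -> (g ^+ 2) ^+ 2 <= M ^+ 2 * G ^+ 2.
  move=> g0 gM gG1; rewrite -exprM (exprM g 2 2) -(mulrC (G ^+ 2)) expr2.
  by rewrite ler_pM ?sqr_ge0// lerXn2r// nnegrE (le_trans g0).
have Hx := H1 _ _ gx0 gxM gG; have Hy := H1 _ _ gy0 gyM gG'.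
have Nx := sqr_ge0 (gx ^+ 2); have Ny := sqr_ge0 (gy ^+ 2).
case: kx ky => -[]; rewrite ?mulr1n ?mulr0n ?mulr1 ?mulr0 ?mul0r ?mul1r
  ?subr0 ?sub0r ?subrr ?addr0 ?add0r ?mul0r ?sqrrN ?mulr0 ?addr0 //.
- have -> : (gx ^+ 2 - gy ^+ 2) ^+ 2 = (gx + gy) ^+ 2 * (gx - gy) ^+ 2 by ring.
  have -> : 4 * M ^+ 2 = (M + M) ^+ 2 by ring.
  by rewrite ler_wpM2r// lerXn2r ?nnegrE ?addr_ge0// lerD.
- lra.
- lra.
- by rewrite expr0n/=; lra.
Qed.

End Cutoff.

(** * The Agmon estimate for finite forms, and case (a) *)

Section Agmon.
Context {R : realType} {X : choiceType}.
Variables (m : X -> R) (b : X -> X -> R) (q w : X -> R) (lambda : R).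
Variables (k t : seq X) (gbar : X -> R).
Hypothesis m_gt0 : forall x, 0 < m x.
Hypothesis b_graph : is_graph b.
Hypothesis b_lf : locally_finite b.
Hypothesis w_ge0 : forall x, 0 <= w x.
Hypothesis t_hull : hull b k t.
Hypothesis h_ge_w : form_ge m b q lambda w (~` [set` k]).
Implicit Types (f g v phi psi : X -> R) (s : seq X).

Let b_ge0 x y : 0 <= b x y. Proof. by case: b_graph. Qed.
Let b_sym x y : b x y = b y x. Proof. by case: b_graph. Qed.

(* The indicator of X \ K; the list k enumerates K. *)
Definition off (x : X) : R := (x \notin k)%:R.

Lemma off_idem x : off x ^+ 2 = off x.
Proof. by rewrite /off; case: (x \notin k); rewrite ?expr1n ?expr0n. Qed.

(** The last clause is the eikonal inequality |grad g|^2 <= c w g^2, tested on finite lists. For c <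
    1 it lets the gradient of the weight be absorbed by [w]; M only has to be finite and does not
    enter the final bound. *)
Definition admissible (c : R) g (M : R) :=
  [/\ forall x, 0 <= g x <= M, forall x, g x <= gbar x &
      forall s x, uniq s -> \sum_(y <- s) b x y * (g x - g y) ^+ 2 <=
                            2 * c * (g x ^+ 2 * w x * m x)].

(* The error made by cutting off at K: 1 - off x * off y vanishes unless the edge
   (x, y) meets K, and t contains all such edges.  The weight gbar dominates every
   truncation g, so this does not depend on the truncation. *)
Definition boundary f : R := \sum_(x <- t) \sum_(y <- t)
  b x y * (f x ^+ 2 * ((1 - off x * off y) * (gbar x ^+ 2 + gbar y ^+ 2))).

Lemma offM_le1 x y : off x * off y <= 1.
Proof. by rewrite /off -natrM lern1; case: (x \notin k) (y \notin k) => -[]. Qed.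

Lemma boundary_term_ge0 f x y : 0 <=
  b x y * (f x ^+ 2 * ((1 - off x * off y) * (gbar x ^+ 2 + gbar y ^+ 2))).
Proof.
apply: mulr_ge0 => //; apply: mulr_ge0; first exact: sqr_ge0.
by apply: mulr_ge0; [rewrite subr_ge0 offM_le1|rewrite addr_ge0 ?sqr_ge0].
Qed.

Lemma boundary_ge s f : uniq s -> \sum_(x <- s) \sum_(y <- s)
  b x y * (f x ^+ 2 * ((1 - off x * off y) * (gbar x ^+ 2 + gbar y ^+ 2)))
  <= boundary f.
Proof.
move=> us; have [ut kt _] := t_hull.
have out x y : (x \notin t) || (y \notin t) ->
    b x y * (f x ^+ 2 * ((1 - off x * off y) * (gbar x ^+ 2 + gbar y ^+ 2))) = 0.
  move=> xyt; have [xk|xk] := boolP (x \in k).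
    move: xyt; rewrite (kt _ xk)/= => yt.
    by rewrite (notin_hull b_graph t_hull xk yt) mul0r.
  have [yk|yk] := boolP (y \in k).
    move: xyt; rewrite (kt _ yk) orbF => xt.
    by rewrite b_sym (notin_hull b_graph t_hull yk xt) mul0r.
  by rewrite /off xk yk mulr1 subrr mul0r !mulr0.
apply: (@le_trans _ _ (\sum_(x <- s) \sum_(y <- t)
  b x y * (f x ^+ 2 * ((1 - off x * off y) * (gbar x ^+ 2 + gbar y ^+ 2))))).
  apply: ler_sum => x _; apply: sum_le_supp => // [y|y yt].
    exact: boundary_term_ge0.
  by rewrite out// yt orbT.
apply: sum_le_supp => // [x|x xt].
  by apply: sumr_ge0 => y _; exact: boundary_term_ge0.
by rewrite big1// => y _; rewrite out// xt.
Qed.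

(** Sum [cutoff_le] over all edges: admissibility controls the gradient of [g], the gradient of
    [phi] is kept as an error term, and edges meeting K go into [boundary]. The Young weight e is
    chosen later so that (1 + e) c < 1. *)
Lemma cross_le (c e M : R) s f phi g psi : uniq s -> 0 < e -> admissible c g M ->
  (forall x, 0 <= phi x <= 1) ->
  (forall x, psi x = phi x * g x * off x) ->
  2^-1 * \sum_(x <- s) \sum_(y <- s) b x y * (f x * f y * (psi x - psi y) ^+ 2) <=
  (1 + e) * c * \sum_(x <- s) w x * (f x * psi x) ^+ 2 * m x +
  (1 + e^-1) * M ^+ 2 * (\sum_(x <- s) f x ^+ 2 *
      (2^-1 * \sum_(y <- s) b x y * (phi x - phi y) ^+ 2)) +
  2^-1 * boundary f.
Proof.
move=> us e0 [gM gG gGam] phi01 psiE.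
have c1 : 2^-1 * \sum_(x <- s) \sum_(y <- s) b x y * (f x * f y * (psi x - psi y) ^+ 2)
   <= 2^-1 * \sum_(x <- s) \sum_(y <- s) b x y * (f x ^+ 2 * (psi x - psi y) ^+ 2).
  rewrite ler_pM2l ?invr_gt0//.
  apply: (sum_cross_le b_graph s f (D := fun x y => (psi x - psi y) ^+ 2)).
    by move=> x y; exact: sqr_ge0.
  by move=> x y; rewrite -(opprB (psi x)) sqrrN.
apply: (le_trans c1).
rewrite mulr_sumr mulr_sumr [X in _ + X + _]mulr_sumr.
apply: (@le_trans _ _ (\sum_(x <- s) ((1 + e) * c * (w x * (f x * psi x) ^+ 2 * m x) +
  (1 + e^-1) * M ^+ 2 * (f x ^+ 2 *
      (2^-1 * \sum_(y <- s) b x y * (phi x - phi y) ^+ 2)) +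
  2^-1 * \sum_(y <- s)
    b x y * (f x ^+ 2 * ((1 - off x * off y) * (gbar x ^+ 2 + gbar y ^+ 2)))))); last first.
  by rewrite !big_split/= lerD2l -mulr_sumr ler_pM2l ?invr_gt0// boundary_ge.
apply: ler_sum => x _.
apply: (@le_trans _ _ (2^-1 * \sum_(y <- s) (
    (1 + e) * (off x * phi x ^+ 2) * f x ^+ 2 * (b x y * (g x - g y) ^+ 2) +
    (1 + e^-1) * M ^+ 2 * f x ^+ 2 * (b x y * (phi x - phi y) ^+ 2) +
    b x y * (f x ^+ 2 * ((1 - off x * off y) * (gbar x ^+ 2 + gbar y ^+ 2)))))).
  rewrite ler_pM2l ?invr_gt0//; apply: ler_sum => y _.
  have := cutoff_le (x \notin k) (y \notin k) e0 (gM x) (gM y) (gG x) (gG y)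
    (phi01 x) (phi01 y).
  rewrite -/(off x) -/(off y) -!psiE => H.
  have bf : 0 <= b x y * f x ^+ 2 by rewrite mulr_ge0 ?sqr_ge0.
  by rewrite mulrA (le_trans (ler_wpM2l bf H))// le_eqVlt; apply/orP; left; apply/eqP; ring.
rewrite !big_split/= -!mulr_sumr.
have := gGam s x us; set S := \sum_(y <- s) b x y * (g x - g y) ^+ 2 => H.
set P := \sum_(y <- s) b x y * (phi x - phi y) ^+ 2.
set T := \sum_(y <- s) b x y * (f x ^+ 2 * _).
have H1 : (1 + e) * (off x * phi x ^+ 2) * f x ^+ 2 * S <=
    (1 + e) * (off x * phi x ^+ 2) * f x ^+ 2 * (2 * c * (g x ^+ 2 * w x * m x)).
  have e1 : 0 <= 1 + e by lra.
  by rewrite ler_wpM2l//; do ![exact: sqr_ge0 | exact: ler0n | apply: mulr_ge0 => //].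
have H2 : (1 + e) * (off x * phi x ^+ 2) * f x ^+ 2 * (2 * c * (g x ^+ 2 * w x * m x)) =
   2 * ((1 + e) * c * (w x * (f x * psi x) ^+ 2 * m x)).
  by rewrite psiE !exprMn off_idem; ring.
rewrite H2 in H1; lra.
Qed.

Lemma form_lower s0 s v : hull b s0 s -> supp_in s0 v ->
  (forall x, x \in k -> v x = 0) ->
  \sum_(x <- s) w x * v x ^+ 2 * m x <=
  hfin m b q s v v - lambda * \sum_(x <- s) v x ^+ 2 * m x.
Proof.
move=> hs sv vk; have [us s0s _] := hs.
have vs x : x \notin s -> v x = 0 by move=> xs; apply: sv; apply: contra xs => /s0s.
have vC : Cc (~` [set` k]) v.
  split; last by move=> x /contrapT; exact: vk.
  apply: (sub_finite_set _ (finite_seq s)) => x /=.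
  by apply: contraNT => /vs ->.
have := h_ge_w vC; rewrite (hformE m_gt0 b_graph q hs sv).
rewrite (rsum_supp us); last by move=> x /vs ->; ring.
by rewrite (rsum_supp us)// => x /vs ->; ring.
Qed.

(** Test with u phi_n g off: by the sign condition the pairing with (H - lambda) u is at most 0, so
    only the cross terms remain. The gradient of phi_n carries the factor M^2, which is fixed while
    n tends to infinity. *)
Lemma agmon_subsolution (c M : R) (u g : X -> R) (phi : nat -> X -> R) (F : seq X) :
  0 <= c < 1 -> admissible c g M ->
  (forall x, x \notin k -> u x * (formalH m b q u x - lambda * u x) <= 0) ->
  (forall n, Cc [set: X] (phi n)) ->
  (forall n x, 0 <= phi n x <= 1) ->
  (forall x, phi n x @[n --> \oo] --> (1 : R)) ->
  (forall d : R, 0 < d -> exists N, forall n s, (N <= n)%N -> uniq s ->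
     \sum_(x <- s) u x ^+ 2 * grad2 m b (phi n) x * m x <= d) ->
  uniq F ->
  (1 - c) * \sum_(x <- F) w x * (u x * g x * off x) ^+ 2 * m x <= boundary u.
Proof.
move=> /andP[c0 c1] gA sub_u phiC phi01 phi1 phiE uF.
pose psi n x := phi n x * g x * off x.
(* With this e, (1 + e) c <= (1 + c) / 2, so absorption leaves the fraction (1 - c) / 2 of the
   weighted sum. *)
pose e := (1 - c) / 2; have e0 : 0 < e by rewrite /e; lra.
have ec : (1 + e) * c <= (1 + c) / 2.
  by rewrite /e; have := mulr_ge0 c0 c0; nra.
pose C := (1 + e^-1) * M ^+ 2.
have C0 : 0 <= C.
  by rewrite /C mulr_ge0 ?sqr_ge0// addr_ge0// invr_ge0 ltW.
have main n d : (forall s, uniq s ->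
     \sum_(x <- s) u x ^+ 2 * grad2 m b (phi n) x * m x <= d) ->
  (1 - c) / 2 * \sum_(x <- F) w x * (u x * psi n x) ^+ 2 * m x <=
     C * d + 2^-1 * boundary u.
  move=> Ed; have [finphi _] := phiC n.
  have [s0 us0 s0E] := finite_set_seq finphi.
  have sphi : supp_in s0 (phi n).
    by move=> x; apply: contraNeq => px; apply/s0E.
  have [s hs] := hull_exists s0 b_lf; have [us s0s _] := hs.
  have spsi : supp_in s0 (psi n) by move=> x /sphi px; rewrite /psi px !mul0r.
  have term0 x : 0 <= w x * (u x * psi n x) ^+ 2 * m x.
    by rewrite mulr_ge0 ?(ltW (m_gt0 x))// mulr_ge0 ?sqr_ge0.
  set T := \sum_(x <- s) w x * (u x * psi n x) ^+ 2 * m x.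
  have FT : \sum_(x <- F) w x * (u x * psi n x) ^+ 2 * m x <= T.
    apply: sum_le_supp => // x xs; rewrite spsi ?mulr0 ?expr0n ?mulr0 ?mul0r//.
    by apply: contra xs => /s0s.
  have supsi : supp_in s0 (u \* psi n) by move=> x /spsi px /=; rewrite px mulr0.
  have psik x : x \in k -> (u \* psi n) x = 0 by move=> xk; rewrite /= /psi /off xk !mulr0.
  have := form_lower hs supsi psik.
  rewrite hfin_ground_state -/T (green m_gt0 b_graph q u hs); last first.
    by move=> x /spsi ->; rewrite expr0n mulr0.
  move=> /= lower.
  have cross := cross_le u us e0 gA (phi01 n) (fun x => erefl (psi n x)).
  rewrite -/T -/C in cross.
  have grad : \sum_(x <- s) u x ^+ 2 *
      (2^-1 * \sum_(y <- s) b x y * (phi n x - phi n y) ^+ 2) <= d.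
    apply: le_trans (Ed s us); apply: ler_sum => x _.
    by rewrite -mulrA ler_wpM2l ?sqr_ge0// sum_grad2_le.
  have sol : \sum_(x <- s) u x * psi n x ^+ 2 * formalH m b q u x * m x -
     lambda * \sum_(x <- s) (u x * psi n x) ^+ 2 * m x <= 0.
    rewrite mulr_sumr -sumrB; apply: sumr_le0 => x _.
    have [xk|xk] := boolP (x \in k).
      by rewrite /psi /off xk; rewrite !mulr0 expr0n !mulr0 !mul0r mulr0 subr0.
    rewrite (_ : _ - _ = psi n x ^+ 2 * m x *
      (u x * (formalH m b q u x - lambda * u x))); last by ring.
    by rewrite mulr_ge0_le0 ?sub_u// mulr_ge0 ?sqr_ge0// ltW.
  have T0 : 0 <= T by exact: sumr_ge0.
  have Cd := ler_wpM2l C0 grad.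
  have Tc := ler_wpM2r T0 ec.
  have cc : 0 <= (1 - c) / 2 by lra.
  have := ler_wpM2l cc FT; lra.
rewrite -subr_le0.
pose A n := (1 - c) * \sum_(x <- F) w x * (u x * psi n x) ^+ 2 * m x - boundary u.
apply: (@cvgn_le0 _ A).
  apply: cvgB; last exact: cvg_cst.
  apply: cvgMl_tmp; apply: cvg_sum_seq => x.
  apply: cvgMr_tmp; apply: cvgMl_tmp.
  have L : u x * psi n x @[n --> \oo] --> u x * g x * off x.
    rewrite -mulrA; apply: cvgMl_tmp; apply: cvgMr_tmp.
    by rewrite -[X in _ --> X]mul1r; apply: cvgMr_tmp; exact: phi1.
  by rewrite expr2; apply: cvgM.
move=> d d0.
(* The gradient error is multiplied by C and then doubled, so d / (2 (C + 1)) is small enough;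
   adding 1 avoids dividing by 0. *)
have C1 : 0 < 2 * (C + 1) by lra.
have [N HN] := phiE _ (divr_gt0 d0 C1).
exists N => n Nn.
have := main n _ (fun s us => HN n s Nn us).
have : C * (d / (2 * (C + 1))) <= d / 2.
  rewrite mulrA ler_pdivrMr//; have := mulr_ge0 C0 (ltW d0); lra.
rewrite /A; lra.
Qed.

Lemma hfin_shift (C : R) s f v :
  hfin m b (fun x => q x + C) s f v = hfin m b q s f v + C * \sum_(x <- s) f x * v x * m x.
Proof.
rewrite /hfin -addrA; congr (_ + _); rewrite mulr_sumr -big_split/=.
by apply: eq_bigr => x _; ring.
Qed.

Lemma hfinBl (p : X -> R) s f g v :
  hfin m b p s (f \- g) v = hfin m b p s f v - hfin m b p s g v.
Proof.
rewrite /hfin /energy opprD addrACA -mulrBr -!sumrB; congr (_ * _ + _).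
  apply: eq_bigr => x _; rewrite -sumrB.
  by apply: eq_bigr => y _ /=; ring.
by apply: eq_bigr => x _ /=; ring.
Qed.

Lemma hfin_sqrD (p : X -> R) (r : R) s f v :
  hfin m b p s (fun x => f x + r * v x) (fun x => f x + r * v x) =
  hfin m b p s f f + 2 * r * hfin m b p s f v + r ^+ 2 * hfin m b p s v v.
Proof.
have en : energy b s (fun x => f x + r * v x) (fun x => f x + r * v x) =
    energy b s f f + 2 * r * energy b s f v + r ^+ 2 * energy b s v v.
  rewrite /energy !(mulrCA _ 2^-1) -!mulrDr; congr (_ * _).
  rewrite !mulr_sumr -!big_split/=; apply: eq_bigr => x _.
  by rewrite !mulr_sumr -!big_split/=; apply: eq_bigr => y _; ring.
have pot : \sum_(x <- s) p x * (f x + r * v x) * (f x + r * v x) * m x =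
    \sum_(x <- s) p x * f x * f x * m x +
    2 * r * (\sum_(x <- s) p x * f x * v x * m x) +
    r ^+ 2 * (\sum_(x <- s) p x * v x * v x * m x).
  by rewrite !mulr_sumr -!big_split/=; apply: eq_bigr => x _; ring.
by rewrite /hfin en pot; ring.
Qed.

Lemma hfin_posneg s v : hfin m b q s v v =
  hfin m b q^\+ s v v - \sum_(x <- s) q^\- x * v x ^+ 2 * m x.
Proof.
rewrite /hfin -addrA -sumrB; congr (_ + _); apply: eq_bigr => x _.
have qE : q x = q^\+ x - q^\- x by rewrite -[in LHS](funrposBneg q).
by rewrite {1}qE; ring.
Qed.

(** Bounds multiplication by g^2 1_{X \ K} in the form. Shrinking a function shrinks only the
    positive part of the potential term, hence [q^\+] on the right. *)
Lemma hfin_cutoff_le (c M : R) s f g v : uniq s -> admissible c g M ->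
  (forall x, v x = f x * (g x ^+ 2 * off x)) ->
  hfin m b q s v v <= 2 * M ^+ 4 * hfin m b q^\+ s f f +
    8 * c * M ^+ 2 * (\sum_(x <- s) w x * (f x * g x * off x) ^+ 2 * m x) +
    M ^+ 2 * boundary f.
Proof.
move=> us [gM gG gGam] vE; pose G x := g x ^+ 2 * off x.
have G0M x : 0 <= G x <= M ^+ 2.
  have /andP[g0 gM'] := gM x.
  have gg : g x ^+ 2 <= M ^+ 2 by rewrite lerXn2r// nnegrE (le_trans g0).
  rewrite /G /off; case: (x \notin k); rewrite ?mulr1 ?mulr0 ?lexx ?sqr_ge0//.
have G2M x : G x ^+ 2 <= M ^+ 4.
  have /andP[G0 GM] := G0M x.
  by rewrite (exprM M 2 2) lerXn2r// nnegrE (le_trans G0).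
have {}vE x : v x = f x * G x by exact: vE.
have en : energy b s v v <= 2 * M ^+ 4 * energy b s f f +
    8 * c * M ^+ 2 * (\sum_(x <- s) w x * (f x * g x * off x) ^+ 2 * m x) +
    M ^+ 2 * boundary f.
  apply: (@le_trans _ _ (\sum_(x <- s) \sum_(y <- s) (
     M ^+ 4 * (b x y * ((f x - f y) * (f x - f y))) +
     4 * M ^+ 2 * off x * f x ^+ 2 * (b x y * (g x - g y) ^+ 2) +
     M ^+ 2 * (b x y * (f x ^+ 2 * ((1 - off x * off y) * (gbar x ^+ 2 + gbar y ^+ 2))))))).
    rewrite /energy mulr_sumr; apply: ler_sum => x _; rewrite mulr_sumr.
    apply: ler_sum => y _.
    have H := cutoff_sq_le (x \notin k) (y \notin k) (gM x) (gM y) (gG x) (gG y).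
    rewrite -/(off x) -/(off y) -/(G x) -/(G y) in H.
    (* Product rule: v x - v y = f x (G x - G y) + G y (f x - f y), with G y <= M^2. *)
    have H1 : (v x - v y) ^+ 2 <=
        2 * f x ^+ 2 * (G x - G y) ^+ 2 + 2 * M ^+ 4 * (f x - f y) ^+ 2.
      have H2 : (v x - v y) ^+ 2 <=
          2 * f x ^+ 2 * (G x - G y) ^+ 2 + 2 * G y ^+ 2 * (f x - f y) ^+ 2.
        rewrite -subr_ge0 (_ : _ - _ = (f x * (G x - G y) - G y * (f x - f y)) ^+ 2).
          exact: sqr_ge0.
        by rewrite !vE; ring.
      by rewrite (le_trans H2)// lerD2l ler_wpM2r ?sqr_ge0// ler_pM2l.
    have H2 := ler_wpM2l (sqr_ge0 (f x)) H.
    rewrite mulrCA -expr2.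
    have : 2^-1 * (v x - v y) ^+ 2 <=
        f x ^+ 2 * (4 * M ^+ 2 * (off x * (g x - g y) ^+ 2) +
        M ^+ 2 * ((1 - off x * off y) * (gbar x ^+ 2 + gbar y ^+ 2))) +
        M ^+ 4 * (f x - f y) ^+ 2 by lra.
    move=> /(ler_wpM2l (b_ge0 x y)) /le_trans; apply.
    by rewrite le_eqVlt; apply/orP; left; apply/eqP; ring.
  have -> : 2 * M ^+ 4 * energy b s f f =
      M ^+ 4 * \sum_(x <- s) \sum_(y <- s) b x y * ((f x - f y) * (f x - f y)).
    by rewrite /energy; field.
  have bd := ler_wpM2l (sqr_ge0 M) (boundary_ge f us).
  rewrite (le_trans _ (lerD (lexx _) bd))// !mulr_sumr -!big_split/=.
  apply: ler_sum => x _; rewrite !big_split/= -!mulr_sumr lerD2r lerD2l.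
  have := gGam s x us; set S := \sum_(y <- s) _ => H.
  have H1 : 4 * M ^+ 2 * off x * f x ^+ 2 * S <=
      4 * M ^+ 2 * off x * f x ^+ 2 * (2 * c * (g x ^+ 2 * w x * m x)).
    by rewrite ler_wpM2l//; do ![exact: sqr_ge0 | exact: ler0n | apply: mulr_ge0 => //].
  rewrite (le_trans H1)// le_eqVlt; apply/orP; left; apply/eqP.
  by rewrite !exprMn off_idem; ring.
suff pot : \sum_(x <- s) q x * v x * v x * m x <=
    2 * M ^+ 4 * \sum_(x <- s) q^\+ x * f x * f x * m x by rewrite /hfin; lra.
rewrite mulr_sumr; apply: ler_sum => x _.
have -> : q x * v x * v x * m x = q x * (f x ^+ 2 * m x * G x ^+ 2) by rewrite vE; ring.
have -> : 2 * M ^+ 4 * (q^\+ x * f x * f x * m x) =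
    q^\+ x * (f x ^+ 2 * m x * (2 * M ^+ 4)) by ring.
have fm : 0 <= f x ^+ 2 * m x by rewrite mulr_ge0 ?sqr_ge0 ?ltW.
have qq : q x <= q^\+ x by rewrite /funrpos le_max lexx.
have q0 := funrpos_ge0 q x.
apply: (@le_trans _ _ (q^\+ x * (f x ^+ 2 * m x * G x ^+ 2))).
  by rewrite ler_wpM2r// mulr_ge0 ?sqr_ge0.
have := G2M x; have := sqr_ge0 (G x) => *.
by rewrite ler_wpM2l// ler_wpM2l//; lra.
Qed.

Lemma Cc_supp v : Cc [set: X] v -> exists2 s, uniq s & supp_in s v.
Proof.
move=> [fv _]; have [s us sE] := finite_set_seq fv; exists s => // x.
by apply: contraNeq => vx; apply/sE.
Qed.

Lemma supp_Cc s v : supp_in s v -> Cc [set: X] v.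
Proof.
move=> sv; split; last by move=> x /(_ I).
apply: (sub_finite_set _ (finite_seq s)) => x /=.
by apply: contraNT => /sv ->.
Qed.

Lemma supp_in_hull s0 s v : hull b s0 s -> supp_in s0 v -> supp_in s v.
Proof. by move=> [_ s0s _] sv x xs; apply: sv; apply: contra xs => /s0s. Qed.

Lemma hfin_ge0 : bounded_from_below m b q -> exists2 C : R, 0 <= C &
  forall s0 s v, hull b s0 s -> supp_in s0 v ->
    0 <= hfin m b (fun x => q x + C) s v v.
Proof.
move=> [C hC]; exists `|C| => // s0 s v hs sv.
have us : uniq s by case: hs.
have := hC v (supp_Cc sv); rewrite (hformE m_gt0 b_graph q hs sv).
rewrite (rsum_supp us); last by move=> x /(supp_in_hull hs sv) ->; ring.
move=> H; rewrite hfin_shift.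
have -> : \sum_(x <- s) v x * v x * m x = \sum_(x <- s) v x ^+ 2 * m x.
  by apply: eq_bigr => x _; rewrite expr2.
set S := \sum_(_ <- _) _ in H *.
have S0 : 0 <= S by apply: sumr_ge0 => x _; rewrite mulr_ge0 ?sqr_ge0// ltW.
have := ler_wpM2r S0 (ler_norm C); lra.
Qed.

(** Since h_q is h_{q_+} minus the q_- term, the defining bound of V rearranges to control of
    h_{q_+} by h and the l^2 norm. *)
Lemma classV_le : classV m b q -> exists eps C : R, [/\ 0 < eps, 0 < C &
  forall s0 s v, hull b s0 s -> supp_in s0 v ->
    eps * hfin m b q^\+ s v v <=
    hfin m b q s v v + C * \sum_(x <- s) v x ^+ 2 * m x].
Proof.
move=> [eps [C [e0 C0 hV]]]; exists eps, C; split=> // s0 s v hs sv.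
have us : uniq s by case: hs.
have := hV v (supp_Cc sv); rewrite (hformE m_gt0 b_graph _ hs sv).
rewrite (rsum_supp us); last by move=> x /(supp_in_hull hs sv) ->; ring.
rewrite (rsum_supp us); last by move=> x /(supp_in_hull hs sv) ->; ring.
by rewrite hfin_posneg; lra.
Qed.

(** * Case (b): form approximants f_n in C_c(X) *)

Section Approximation.
Variables (f : nat -> X -> R) (u : X -> R).
Hypothesis f_Cc : forall n, Cc [set: X] (f n).
Hypothesis f_cvg : forall x, f n x @[n --> \oo] --> u x.
Hypothesis f_l2 : forall d : R, 0 < d -> exists N, forall i j s,
  (N <= i)%N -> (N <= j)%N -> uniq s ->
  \sum_(x <- s) (f i x - f j x) ^+ 2 * m x <= d.
Hypothesis f_form : forall d : R, 0 < d -> exists N, forall i j,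
  (N <= i)%N -> (N <= j)%N -> `|hform m b q (f i \- f j)| < d.
Hypothesis h_bounded : bounded_from_below m b q.
Hypothesis q_V : classV m b q.

(** Cauchy sequences are bounded: f_n is compared with the fixed f_N, and class V turns the bound on
    h into one on h_{q_+}. *)
Lemma approx_bounded : exists B N, forall n, (N <= n)%N ->
  forall s0 s, hull b s0 s -> supp_in s0 (f n) ->
    \sum_(x <- s) f n x ^+ 2 * m x <= B /\ hfin m b q^\+ s (f n) (f n) <= B.
Proof.
have [N1 l2] := f_l2 ltr01; have [N2 fm] := f_form ltr01.
have [C C0 pos] := hfin_ge0 h_bounded.
have [eps [D [eps0 D0 hV]]] := classV_le q_V.
pose N := maxn N1 N2; have [sN usN sNf] := Cc_supp (f_Cc N).
have [tN htN] := hull_exists sN b_lf.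
pose S := \sum_(x <- sN) f N x ^+ 2 * m x.
pose B1 := 2 + 2 * S.
pose B2 := 2 * (1 + C) + 2 * (hform m b q (f N) + C * S).
exists (Num.max B1 (eps^-1 * (B2 + D * B1))), N => n Nn s0 s1 hs1 s1f.
have [n1 n2] : (N1 <= n)%N /\ (N2 <= n)%N.
  by move: Nn; rewrite geq_max => /andP[].
have [N1N N2N] : (N1 <= N)%N /\ (N2 <= N)%N by rewrite leq_maxl leq_maxr.
have us1 : uniq s1 by case: hs1.
pose t0 := s0 ++ sN; have [t1 ht1] := hull_exists t0 b_lf.
pose s := undup (s1 ++ t1).
have us : uniq s by exact: undup_uniq.
have hs : hull b t0 s.
  by apply: (hull_sub ht1) => // x xt; rewrite mem_undup mem_cat xt orbT.
have s1s : {subset s1 <= s} by move=> x xs; rewrite mem_undup mem_cat xs.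
have hs' : hull b s0 s by exact: (hull_sub hs1).
have t0N : supp_in t0 (f N) by move=> x; rewrite mem_cat negb_or => /andP[_ /sNf].
have t0n : supp_in t0 (f n) by move=> x; rewrite mem_cat negb_or => /andP[/s1f].
have t0a : supp_in t0 (f n \- f N) by move=> x xt /=; rewrite t0N// t0n// subrr.
have sNs : {subset sN <= s}.
  by move=> x xs; case: hs => _ + _; apply; rewrite mem_cat xs orbT.
have SE : \sum_(x <- s) f N x ^+ 2 * m x = S.
  by apply: (sum_supp usN us sNs) => x /sNf ->; rewrite expr0n mul0r.
have l2n := l2 n N s n1 N1N us.
have -> : \sum_(x <- s1) f n x ^+ 2 * m x = \sum_(x <- s) f n x ^+ 2 * m x.
  symmetry; apply: (sum_supp us1 us s1s) => x /(supp_in_hull hs1 s1f) ->.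
  by rewrite expr0n mul0r.
have -> : hfin m b q^\+ s1 (f n) (f n) = hfin m b q^\+ s (f n) (f n).
  by rewrite -(hformE m_gt0 b_graph _ hs1 s1f) -(hformE m_gt0 b_graph _ hs' s1f).
have b1 : \sum_(x <- s) f n x ^+ 2 * m x <= B1.
  apply: (@le_trans _ _ (\sum_(x <- s)
    (2 * ((f n x - f N x) ^+ 2 * m x) + 2 * (f N x ^+ 2 * m x)))).
    apply: ler_sum => x _; rewrite -subr_ge0.
    rewrite (_ : _ - _ = (f n x - 2 * f N x) ^+ 2 * m x); last by ring.
    by rewrite mulr_ge0 ?sqr_ge0// ltW.
  by rewrite big_split/= -!mulr_sumr SE /B1; lra.
split; first by rewrite le_max b1.
rewrite le_max; apply/orP; right; rewrite ler_pdivlMl//.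
apply: (le_trans (hV _ _ _ hs' s1f)).
suff : hfin m b q s (f n) (f n) <= B2 by have := ler_wpM2l (ltW D0) b1; lra.
pose p x := q x + C.
have p1 : hfin m b p s (f n) (f n) = hfin m b p s (f N) (f N) +
    2 * 1 * hfin m b p s (f N) (f n \- f N) +
    1 ^+ 2 * hfin m b p s (f n \- f N) (f n \- f N).
  by rewrite -hfin_sqrD; congr hfin; apply/funext => x /=; ring.
(* Together with [p1] this is the parallelogram law for h + C; dropping the nonnegative [p3] gives
   (h + C)(f_n) <= 2 (h + C)(f_N) + 2 (h + C)(f_n - f_N). *)
have p2 := hfin_sqrD p (-1) s (f N) (f n \- f N).
have p3 : 0 <= hfin m b p s (fun x => f N x + -1 * (f n \- f N) x)
    (fun x => f N x + -1 * (f n \- f N) x).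
  by apply: (pos t0) => // x xt /=; rewrite t0N// t0n//; ring.
have p4 : hfin m b p s (f n \- f N) (f n \- f N) <= 1 + C.
  rewrite /p hfin_shift -(hformE m_gt0 b_graph q hs t0a) lerD//.
    by apply: le_trans (ltW (fm n N n2 N2N)); exact: ler_norm.
  by rewrite -[leRHS]mulr1 ler_wpM2l.
have p5 : hfin m b p s (f N) (f N) = hform m b q (f N) + C * S.
  by rewrite /p hfin_shift -(hformE m_gt0 b_graph q hs t0N) -SE; congr (_ + _ * _).
have p6 : hfin m b q s (f n) (f n) <= hfin m b p s (f n) (f n).
  rewrite /p hfin_shift lerDl mulr_ge0// sumr_ge0// => x _.
  by rewrite -expr2 mulr_ge0 ?sqr_ge0// ltW.
rewrite /B2; lra.
Qed.

Lemma formalH_cvg x : formalH m b q (f n) x @[n --> \oo] --> formalH m b q u x.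
Proof.
have [s hs] := hull_exists [:: x] b_lf.
have E g : formalH m b q g x =
    (m x)^-1 * (\sum_(y <- s) b x y * (g x - g y)) + q x * g x.
  by rewrite /formalH (rsum_nbr b_graph (fun y => g x - g y) hs (mem_head _ _)).
rewrite E; under eq_cvg do rewrite E.
apply: cvgD; last exact: cvgMl_tmp.
apply: cvgMl_tmp; apply: cvg_sum_seq => y.
by apply: cvgMl_tmp; apply: cvgB.
Qed.

Lemma boundary_cvg : boundary (f n) @[n --> \oo] --> boundary u.
Proof.
apply: cvg_sum_seq => x; apply: cvg_sum_seq => y.
apply: cvgMl_tmp; apply: cvgMr_tmp; rewrite expr2.
by under eq_cvg do rewrite expr2; apply: cvgM.
Qed.

(** The right side runs over [s0] only, so the list stays fixed when [g] runs through a sequence,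
    even if [s] has to grow with it. *)
Lemma hfin_pairing s0 s v g : uniq s0 -> hull b s0 s -> supp_in s0 v ->
  hfin m b (fun x => q x + - lambda) s g v =
  \sum_(x <- s0) v x * (formalH m b q g x - lambda * g x) * m x.
Proof.
move=> us0 hs sv; have [us s0s _] := hs.
rewrite hfin_shift (green m_gt0 b_graph q g hs sv) mulr_sumr -big_split/=.
rewrite -(sum_supp us0 us s0s); last by move=> x /sv ->; rewrite !mul0r.
by apply: eq_bigr => x _; ring.
Qed.

Hypothesis u_sol : forall x, x \notin k -> formalH m b q u x - lambda * u x = 0.

(* Split f_n = (f_n - f_j) + f_j and let j tend to infinity: the pairing of f_j
   with v_n is a finite sum converging to that of u, which is 0, and the pairing
   of f_n - f_j is small by Cauchy-Schwarz (in AM-GM form) for h + C >= 0. *)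
Lemma pairing_small (v : nat -> X -> R) (B : R) (N0 : nat) : 0 <= B ->
  (forall n x, f n x = 0 -> v n x = 0) ->
  (forall n x, x \in k -> v n x = 0) ->
  (forall n s0 s, (N0 <= n)%N -> hull b s0 s -> supp_in s0 (f n) ->
     hfin m b q s (v n) (v n) <= B /\ \sum_(x <- s) v n x ^+ 2 * m x <= B) ->
  forall d : R, 0 < d -> exists N, forall n s0 s, (N <= n)%N ->
    uniq s0 -> hull b s0 s -> supp_in s0 (f n) ->
    hfin m b (fun x => q x + - lambda) s (f n) (v n) <= d.
Proof.
move=> B0 vf vk vB d d0; have [C C0 pos] := hfin_ge0 h_bounded.
pose L := `|lambda + C|; have L0 : 0 <= L by exact: normr_ge0.
(* For a = f_n - f_j, E r^2 bounds 2 r times the pairing of a with v_n: 1 comes from (h + C)(a), (1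
   + C) B from (h + C)(v_n), and L (1 + B) from replacing the shift C by -lambda. Hence r = d /
   E. *)
pose E := 1 + (1 + C) * B + L * (1 + B).
have E0 : 0 < E.
  have := mulr_ge0 L0 B0; have := mulr_ge0 C0 B0; rewrite /E; nra.
pose r := d / E; have r0 : 0 < r by exact: divr_gt0.
have r2 : 0 < r ^+ 2 by rewrite exprn_gt0.
have C1 : 0 < 2 * (C + 1) by lra.
have [N1 l2] := f_l2 (divr_gt0 r2 C1).
have r22 : 0 < r ^+ 2 / 2 by rewrite divr_gt0.
have [N2 fm] := f_form r22.
exists (maxn N0 (maxn N1 N2)) => n s0 s1.
rewrite !geq_max => /andP[n0 /andP[n1 n2]] us0 hs1 s0f.
have s0v : supp_in s0 (v n) by move=> x /s0f; exact: vf.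
rewrite (hfin_pairing _ us0 hs1 s0v).
pose D g := \sum_(x <- s0) v n x * (formalH m b q g x - lambda * g x) * m x.
rewrite -/(D (f n)).
have Dlim : D (f j) @[j --> \oo] --> D u.
  apply: cvg_sum_seq => x; apply: cvgMr_tmp; apply: cvgMl_tmp.
  by apply: cvgB; [exact: formalH_cvg|exact: cvgMl_tmp].
have Du : D u = 0.
  rewrite /D big1// => x _; have [xk|xk] := boolP (x \in k).
    by rewrite vk// !mul0r.
  by rewrite u_sol// mulr0 mul0r.
suff diff j : (maxn N1 N2 <= j)%N -> D (f n) - D (f j) <= d.
  have : D (f n) - D (f j) @[j --> \oo] --> D (f n) - D u.
    by apply: cvgB => //; exact: cvg_cst.
  rewrite Du subr0 => /cvgr_to_le; apply.
  near=> j; apply: diff; near: j; exact: nbhs_infty_ge.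
rewrite geq_max => /andP[j1 j2].
have [sj usj sjf] := Cc_supp (f_Cc j).
have [s hs] := hull_exists (s0 ++ sj) b_lf; have [us _ _] := hs.
have hs0 : hull b s0 s by apply: (hull_sub hs) => // x xs; rewrite mem_cat xs.
rewrite /D -!(hfin_pairing _ us0 hs0 s0v) -hfinBl.
set a := f n \- f j.
have sa : supp_in (s0 ++ sj) a.
  by move=> x; rewrite mem_cat negb_or => /andP[/s0f xa /sjf xb]; rewrite /a/= xa xb subrr.
have sv : supp_in (s0 ++ sj) (v n).
  by move=> x; rewrite mem_cat negb_or => /andP[/s0v].
have [vB1 vB2] := vB n s0 s n0 hs0 s0f.
have l2a : \sum_(x <- s) a x * a x * m x <= r ^+ 2 / (2 * (C + 1)) by exact: l2.
have fa : hfin m b q s a a <= r ^+ 2 / 2.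
  rewrite -(hformE m_gt0 b_graph q hs sa).
  by apply: le_trans (ltW (fm n j n2 j2)); exact: ler_norm.
have Ca : C * (\sum_(x <- s) a x * a x * m x) <= r ^+ 2 / 2.
  apply: le_trans (ler_wpM2l C0 l2a) _.
  by rewrite mulrA ler_pdivrMr//; lra.
have a2 : \sum_(x <- s) a x * a x * m x <= r ^+ 2.
  apply: le_trans l2a _; rewrite ler_pdivrMr//.
  by have := mulr_ge0 (ltW r2) C0; lra.
have Cv := ler_wpM2l C0 vB2.
have P : 0 <= hfin m b (fun x => q x + C) s
    (fun x => a x + - r * v n x) (fun x => a x + - r * v n x).
  by apply: (pos _ _ _ hs) => x xs; rewrite sa// sv// mulr0 addr0.
rewrite hfin_sqrD !hfin_shift in P; rewrite hfin_shift.
set h1 := hfin m b q s a a in fa P; set h2 := hfin m b q s a (v n) in P *.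
set h3 := hfin m b q s (v n) (v n) in vB1 P.
have v2E : \sum_(x <- s) v n x * v n x * m x = \sum_(x <- s) v n x ^+ 2 * m x.
  by apply: eq_bigr => x _; rewrite expr2.
rewrite v2E in P.
set S1 := \sum_(x <- s) a x * a x * m x in l2a Ca a2 P *.
set S2 := \sum_(x <- s) a x * v n x * m x in P *.
set S3 := \sum_(x <- s) v n x ^+ 2 * m x in v2E vB2 Cv P.
(* AM-GM without a case split on the sign of lambda + C: add the nonnegative terms (L + (lambda +
   C)) (a + r v)^2 and (L - (lambda + C)) (a - r v)^2. *)
have cross : - (2 * r * (lambda + C)) * S2 <= L * (S1 + r ^+ 2 * S3).
  rewrite /S1 /S2 /S3 (mulr_sumr _ _ _ (r ^+ 2)) -big_split/= !mulr_sumr.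
  apply: ler_sum => x _.
  have mx := ltW (m_gt0 x).
  have Lp : 0 <= L + (lambda + C).
    by have := ler_norm (- (lambda + C)); rewrite normrN -/L; lra.
  have Lm : 0 <= L - (lambda + C) by rewrite subr_ge0 /L ler_norm.
  have H1 := mulr_ge0 Lp (mulr_ge0 (sqr_ge0 (a x + r * v n x)) mx).
  have H2 := mulr_ge0 Lm (mulr_ge0 (sqr_ge0 (a x - r * v n x)) mx).
  lra.
have r3 := ler_wpM2l (ltW r2) vB1; have r4 := ler_wpM2l (ltW r2) Cv.
have r5 := ler_wpM2l L0 a2.
have r6 := ler_wpM2l L0 (ler_wpM2l (ltW r2) vB2).
have fin : 2 * r * (h2 + - lambda * S2) <= r * (r * E) by rewrite /E; lra.
have rE : r * E = d by rewrite /r divfK// gt_eqF.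
rewrite rE in fin.
rewrite -(ler_pM2l r0); have := mulr_gt0 r0 d0; lra.
Unshelve. all: by end_near. Qed.

Hypothesis gbar_ge1 : forall x, 1 <= gbar x.

(** The trivial weight feeds the preliminary bound on [w]; [gbar_ge1] makes the same boundary term
    serve for it. *)
Lemma admissible_cst1 : admissible 0 (fun=> 1) 1.
Proof.
split=> // [x|s x us]; first by rewrite ler01 lexx.
by rewrite mulr0 mul0r big1// => y _; rewrite subrr expr0n mulr0.
Qed.

(** The argument of case (a) with phi = 1, since f_n already has finite support. The pairing with (H
    - lambda) f_n is no longer of one sign but is made small by [pairing_small]. *)
Lemma agmon_form_domain (c M : R) (g : X -> R) (F : seq X) :
  0 <= c < 1 -> admissible c g M -> uniq F ->
  (1 - c) * \sum_(x <- F) w x * (u x * g x * off x) ^+ 2 * m x <= boundary u.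
Proof.
(* The final absorption: T' is the weighted sum, T'' its part over F, h - l S the pairing, z the
   cross term and y the boundary term. *)
have arith (a h S z y T' T'' d l e : R) :
    T' <= h + z - l * S -> h + - l * S <= d / 2 ->
    z <= (1 + e) * a * T' + 2^-1 * y -> (1 + e) * a * T' <= (1 + a) / 2 * T' ->
    (1 - a) * T'' <= (1 - a) * T' -> (1 - a) * T'' - y <= d by lra.
move=> /andP[c0 c1] gA uF; have [gM gG gGam] := gA.
have [B1 [N1 bd1]] := approx_bounded.
pose B := Num.max B1 0; have B0 : 0 <= B by rewrite le_max lexx orbT.
have B1B : B1 <= B by rewrite le_max lexx.
have [N2 bd2] : exists N, forall n, (N <= n)%N -> boundary (f n) <= boundary u + 1.
  have /cvgrPdist_le/(_ _ ltr01)[N _ HN] := boundary_cvg.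
  exists N => n /HN /=; rewrite ler_norml => /andP[]; lra.
have bdu0 : 0 <= boundary u.
  by apply: sumr_ge0 => x _; apply: sumr_ge0 => y _; exact: boundary_term_ge0.
pose Bb := boundary u + 1; have Bb0 : 0 <= Bb by rewrite /Bb addr_ge0.
pose W := 2 * B + Bb + `|lambda| * B.
have wW n s0 s : (maxn N1 N2 <= n)%N -> hull b s0 s -> supp_in s0 (f n) ->
    \sum_(x <- s) w x * (f n x * off x) ^+ 2 * m x <= W.
  rewrite geq_max => /andP[n1 n2] hs s0f; have [us _ _] := hs.
  have [l2 fm] := bd1 n n1 s0 s hs s0f.
  pose v x := f n x * (1 ^+ 2 * off x).
  have s0v : supp_in s0 v by move=> x /s0f; rewrite /v => ->; rewrite mul0r.
  have vk x : x \in k -> v x = 0 by move=> xk; rewrite /v /off xk !mulr0.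
  have low := form_lower hs s0v vk.
  (* [g = 1] first gives a bound on [w (f n)^2], needed for general [g]. *)
  have cut := hfin_cutoff_le us admissible_cst1 (fun x => erefl (v x)).
  have vE x : v x = f n x * off x by rewrite /v expr1n mul1r.
  under eq_bigr do rewrite -vE.
  have v2 : \sum_(x <- s) v x ^+ 2 * m x <= B.
    apply: le_trans B1B; apply: le_trans l2; apply: ler_sum => x _.
    rewrite ler_wpM2r ?(ltW (m_gt0 x))// vE exprMn off_idem /off.
    by rewrite ler_piMr ?sqr_ge0// lern1; case: (x \notin k).
  have v20 : 0 <= \sum_(x <- s) v x ^+ 2 * m x.
    by apply: sumr_ge0 => x _; rewrite mulr_ge0 ?sqr_ge0// ltW.
  have := bd2 n n2; have := ler_wpM2r v20 (ler_norm (- lambda)); rewrite normrN.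
  have := ler_wpM2l (normr_ge0 lambda) v2.
  rewrite !expr1n !mulr0 !mul0r addr0 in cut.
  rewrite /W /Bb; lra.
pose v n x := f n x * (g x ^+ 2 * off x).
pose N := maxn N1 N2.
(* The first entry bounds h(v_n) through [hfin_cutoff_le], the second the l^2 norm of v_n through
   g^4 <= M^4. *)
pose B' := Num.max (2 * M ^+ 4 * B + 8 * c * M ^+ 2 * (M ^+ 2 * W) + M ^+ 2 * Bb)
  (M ^+ 4 * B).
have B'0 : 0 <= B' by rewrite le_max (mulr_ge0 _ B0) ?orbT// (exprM M 2 2) sqr_ge0.
have gM2 x : g x ^+ 2 <= M ^+ 2.
  by have /andP[g0 gM'] := gM x; rewrite lerXn2r// nnegrE (le_trans g0).
have vB n s0 s : (N <= n)%N -> hull b s0 s -> supp_in s0 (f n) ->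
    hfin m b q s (v n) (v n) <= B' /\ \sum_(x <- s) v n x ^+ 2 * m x <= B'.
  move=> Nn hs s0f; have [us _ _] := hs.
  have [n1 n2] : (N1 <= n)%N /\ (N2 <= n)%N by move: Nn; rewrite geq_max => /andP[].
  have [l2 fm] := bd1 n n1 s0 s hs s0f.
  have W1 := wW n s0 s Nn hs s0f.
  split; rewrite le_max; apply/orP; [left|right].
    apply: (le_trans (hfin_cutoff_le us gA (fun x => erefl (v n x)))).
    have W2 : \sum_(x <- s) w x * (f n x * g x * off x) ^+ 2 * m x <= M ^+ 2 * W.
      apply: le_trans (ler_wpM2l (sqr_ge0 M) W1); rewrite mulr_sumr.
      apply: ler_sum => x _.
      have -> : w x * (f n x * g x * off x) ^+ 2 * m x =
        g x ^+ 2 * (w x * (f n x * off x) ^+ 2 * m x) by ring.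
      rewrite ler_wpM2r// mulr_ge0 ?(ltW (m_gt0 x))// mulr_ge0 ?sqr_ge0//.
    have c8 : 0 <= 8 * c * M ^+ 2 by rewrite mulr_ge0 ?sqr_ge0// mulr_ge0.
    have M4 : 0 <= 2 * M ^+ 4 by rewrite mulr_ge0// (exprM M 2 2) sqr_ge0.
    have := ler_wpM2l M4 (le_trans fm B1B); have := ler_wpM2l c8 W2.
    have := ler_wpM2l (sqr_ge0 M) (bd2 n n2); rewrite -/Bb; lra.
  have M4 : 0 <= M ^+ 4 by rewrite (exprM M 2 2) sqr_ge0.
  apply: le_trans (ler_wpM2l M4 (le_trans l2 B1B)); rewrite mulr_sumr.
  apply: ler_sum => x _; rewrite mulrA ler_wpM2r ?(ltW (m_gt0 x))//.
  rewrite /v !exprMn off_idem [leLHS]mulrC ler_wpM2r ?sqr_ge0//.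
  apply: (@le_trans _ _ ((g x ^+ 2) ^+ 2)).
    by rewrite ler_piMr ?sqr_ge0// /off lern1; case: (x \notin k).
  by rewrite (exprM M 2 2) lerXn2r ?nnegrE ?sqr_ge0.
have vf n x : f n x = 0 -> v n x = 0 by rewrite /v => ->; rewrite mul0r.
have vk n x : x \in k -> v n x = 0 by move=> xk; rewrite /v /off xk !mulr0.
have small := pairing_small B'0 vf vk vB.
pose e := (1 - c) / 2; have e0 : 0 < e by rewrite /e; lra.
have ec : (1 + e) * c <= (1 + c) / 2.
  by rewrite /e; have := mulr_ge0 c0 c0; nra.
pose psi x := 1 * g x * off x.
rewrite -subr_le0.
pose A n := (1 - c) * \sum_(x <- F) w x * (f n x * g x * off x) ^+ 2 * m x - boundary (f n).
apply: (@cvgn_le0 _ A).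
  apply: cvgB; last exact: boundary_cvg.
  apply: cvgMl_tmp; apply: cvg_sum_seq => x.
  apply: cvgMr_tmp; apply: cvgMl_tmp.
  have L : f n x * g x * off x @[n --> \oo] --> u x * g x * off x.
    by apply: cvgMr_tmp; apply: cvgMr_tmp.
  by rewrite expr2; apply: cvgM.
move=> d d0; have d2 : 0 < d / 2 by rewrite divr_gt0.
have [N' small'] := small _ d2.
exists N' => n Nn.
have [s0 us0 s0f] := Cc_supp (f_Cc n).
have [s hs] := hull_exists s0 b_lf; have [us s0s _] := hs.
have s0fp : supp_in s0 (f n \* psi) by move=> x /s0f /= ->; rewrite mul0r.
have fpk x : x \in k -> (f n \* psi) x = 0 by move=> xk; rewrite /= /psi /off xk !mulr0.
have low := form_lower hs s0fp fpk.
have p01 (x : X) : 0 <= (1 : R) <= 1 by rewrite ler01 lexx.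
have cross := cross_le (f n) us e0 gA p01 (fun x => erefl (psi x)).
have grad0 : \sum_(x <- s) f n x ^+ 2 *
    (2^-1 * \sum_(y <- s) b x y * ((1 : R) - 1) ^+ 2) = 0.
  rewrite big1// => x _; rewrite big1 ?mulr0// => y _.
  by rewrite subrr expr0n mulr0.
rewrite grad0 mulr0 addr0 in cross.
have Q := small' n s0 s Nn us0 hs s0f.
rewrite hfin_shift in Q.
rewrite hfin_ground_state in low.
have vpsi : (fun x => f n x * psi x ^+ 2) = v n.
  by apply/funext => x; rewrite /psi /v !exprMn off_idem expr1n mul1r.
rewrite vpsi in low.
have fv : \sum_(x <- s) f n x * v n x * m x = \sum_(x <- s) (f n \* psi) x ^+ 2 * m x.
  by apply: eq_bigr => x _; rewrite -vpsi /=; ring.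
rewrite fv in Q.
set T := \sum_(x <- s) w x * (f n x * psi x) ^+ 2 * m x in cross.
rewrite -/T in low.
have T0 : 0 <= T.
  by apply: sumr_ge0 => x _; rewrite mulr_ge0 ?(ltW (m_gt0 x))// mulr_ge0 ?sqr_ge0.
have FT : \sum_(x <- F) w x * (f n x * g x * off x) ^+ 2 * m x <= T.
  rewrite /T; under [leRHS]eq_bigr do rewrite /psi mul1r mulrA.
  apply: sum_le_supp => // x; last first.
    move=> xs; rewrite s0f ?mul0r ?expr0n ?mulr0 ?mul0r//.
    by apply: contra xs => /s0s.
  by rewrite mulr_ge0 ?(ltW (m_gt0 x))// mulr_ge0 ?sqr_ge0.
have Tc := ler_wpM2r T0 ec.
have cc : 0 <= 1 - c by rewrite subr_ge0 ltW.
exact: arith low Q cross Tc (ler_wpM2l cc FT).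
Qed.

End Approximation.

End Agmon.

(** * The distance rho and the admissibility of its exponential weights *)

Section Distance.
Context {R : realType} {X : choiceType}.
Variables (m : X -> R) (b d : X -> X -> R) (w : X -> R) (o : X).
Hypothesis b_graph : is_graph b.
Hypothesis b_conn : graph_connected b.
Hypothesis d_intrinsic : is_intrinsic_metric m b d.
Hypothesis w_ge0 : forall x, 0 <= w x.

Let b_ge0 x y : 0 <= b x y. Proof. by case: b_graph. Qed.
Let d_ge0 x y : 0 <= d x y. Proof. by case: d_intrinsic => -[]. Qed.

Lemma rho_length_ge0 x y : 0 <= rho_length d w x y.
Proof. by rewrite /rho_length le_min ler01/= mulr_ge0// sqrtr_ge0. Qed.

Lemma rho_length_le1 x y : rho_length d w x y <= 1.
Proof. by rewrite /rho_length ge_min lexx. Qed.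

Lemma rho_length_sym x y : rho_length d w x y = rho_length d w y x.
Proof.
by case: d_intrinsic => -[_ _ ds _] _; rewrite /rho_length ds [Num.min (w x) _]minC.
Qed.

Lemma rho_length_sqr_le x y : rho_length d w x y ^+ 2 <= w x * d x y ^+ 2.
Proof.
rewrite -(sqr_sqrtr (w_ge0 x)) -exprMn.
rewrite lerXn2r ?nnegrE ?rho_length_ge0 ?mulr_ge0 ?sqrtr_ge0//.
rewrite /rho_length ge_min; apply/orP; right.
by rewrite ler_wpM2r// ler_wsqrtr// ge_min lexx.
Qed.

Let lengths x := [set l | exists2 p, is_path b o x p &
  l = \sum_(i < size p) rho_length d w (nth o (o :: p) i) (nth o (o :: p) i.+1)].

Let lengths_neq0 x : lengths x !=set0.
Proof. by have [p pp] := b_conn o x; eexists; exists p. Qed.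

Let lengths_lb x : lbound (lengths x) 0.
Proof. by move=> _ [p _ ->]; apply: sumr_ge0 => i _; exact: rho_length_ge0. Qed.

Lemma rho_ge0 x : 0 <= rho b d w o x.
Proof. exact: (lb_le_inf (lengths_neq0 x) (@lengths_lb x)). Qed.

(** Append the edge from x to y to an arbitrary path from [o] to x, then take the infimum over such
    paths. *)
Lemma rho_le_step x y : adj b x y ->
  rho b d w o y <= rho b d w o x + rho_length d w x y.
Proof.
move=> xy; rewrite -lerBlDr.
apply: (lb_le_inf (lengths_neq0 x)) => _ [p [pp px] ->].
rewrite lerBlDr; apply: ge_inf; first by exists 0; exact: lengths_lb.
exists (rcons p y).
  by split; [rewrite rcons_path pp px|rewrite last_rcons].
rewrite size_rcons big_ord_recr/=; congr (_ + _).
  apply: eq_bigr => i _; rewrite -rcons_cons !nth_rcons/= ltnS.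
  by rewrite (ltn_ord i) (ltnW (ltn_ord i)).
rewrite -rcons_cons !nth_rcons/= ltnS leqnn ltnn eqxx.
by rewrite -[nth _ _ _]/(nth o (o :: p) (size p)) nth_last/= px.
Qed.

Lemma rho_lipschitz x y : adj b x y ->
  `|rho b d w o x - rho b d w o y| <= rho_length d w x y.
Proof.
move=> xy; have yx : adj b y x by case: b_graph => _ s _ _; rewrite /adj/= s.
have := rho_le_step xy; have := rho_le_step yx.
by rewrite (rho_length_sym y) ler_norml => *; apply/andP; split; lra.
Qed.

Lemma min_lipschitz (M x y : R) : `|Num.min x M - Num.min y M| <= `|x - y|.
Proof.
wlog xy : x y / x <= y.
  move=> H; have [/H//|/ltW/H] := leP x y.
  by rewrite distrC (distrC y).
rewrite distrC (distrC x) !ger0_norm ?subr_ge0//; last first.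
  by rewrite le_min !ge_min xy lexx orbT.
by rewrite /Num.min; case: (ltP y M) => ?; case: (ltP x M) => ?; lra.
Qed.

(** [expRB_sqr_le] at exponents r/2 times the truncated rho gives r^2 / 4 times (1 + e^r) / 2, which
    is 2 c. The factor w x d(x,y)^2 comes from the Lipschitz bound, and summing b d^2 over y gives
    at most m x. *)
Lemma admissible_expR_rho (r M : R) : 0 <= r ->
  admissible m b w (fun x => expR (r / 2 * rho b d w o x))
    (r ^+ 2 * ((1 + expR r) / 16))
    (fun x => expR (r / 2 * Num.min (rho b d w o x) M)) (expR (r / 2 * M)).
Proof.
move=> r0; have r2 : 0 <= r / 2 by lra.
split.
- by move=> x; rewrite expR_ge0 ler_expR ler_wpM2l// ge_min lexx orbT.
- by move=> x; rewrite ler_expR ler_wpM2l// ge_min lexx.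
move=> s x us; pose g y := expR (r / 2 * Num.min (rho b d w o y) M).
have step y : b x y * (g x - g y) ^+ 2 <=
    r ^+ 2 * ((1 + expR r) / 8) * g x ^+ 2 * w x * (b x y * d x y ^+ 2).
  have [bxy|bxy] := eqVneq (b x y) 0; first by rewrite bxy !mul0r mulr0.
  have xy : adj b x y by rewrite /adj/= lt_neqAle eq_sym bxy b_ge0.
  rewrite [leRHS]mulrCA ler_wpM2l// /g.
  set X0 := Num.min _ M; set Y0 := Num.min _ M.
  have XY : `|X0 - Y0| <= rho_length d w x y.
    exact: le_trans (min_lipschitz _ _ _) (rho_lipschitz xy).
  have XY2 : (X0 - Y0) ^+ 2 <= w x * d x y ^+ 2.
    apply: le_trans (rho_length_sqr_le x y).
    by rewrite -real_normK ?num_real// lerXn2r ?nnegrE ?rho_length_ge0.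
  (* The cap 1 on edge lengths enters here: truncated rho differs by at most 1 along an edge. *)
  have YX : expR (r / 2 * Y0) ^+ 2 <= expR r * expR (r / 2 * X0) ^+ 2.
    rewrite -!expRM_natl -expRD ler_expR.
    have : Y0 <= X0 + 1.
      have := le_trans XY (rho_length_le1 x y).
      by rewrite ler_norml => /andP[]; lra.
    by move=> /(ler_wpM2l r0); lra.
  apply: le_trans (expRB_sqr_le _ _) _.
  have XX := sqr_ge0 (expR (r / 2 * X0)).
  have -> : r ^+ 2 * ((1 + expR r) / 8) * expR (r / 2 * X0) ^+ 2 * w x * d x y ^+ 2 =
    ((r / 2) ^+ 2 * (w x * d x y ^+ 2)) *
    ((1 + expR r) * expR (r / 2 * X0) ^+ 2 / 2) by field.
  apply: ler_pM.
  - exact: sqr_ge0.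
  - by rewrite divr_ge0// addr_ge0 ?sqr_ge0.
  - by rewrite -mulrBr exprMn ler_wpM2l ?sqr_ge0.
  - by lra.
apply: le_trans (ler_sum _ (fun y _ => step y)) _; rewrite -mulr_sumr.
have bd : \sum_(y <- s) b x y * d x y ^+ 2 <= m x.
  case: d_intrinsic => _ /(_ x); rewrite -lee_fin; apply: le_trans.
  by apply: sum_le_esum => // y; rewrite mulr_ge0 ?sqr_ge0.
have P0 : 0 <= r ^+ 2 * ((1 + expR r) / 8) * g x ^+ 2 * w x.
  have E8 : 0 <= (1 + expR r) / 8 by have := expR_ge0 r; lra.
  by do ![exact: sqr_ge0 | exact: E8 | exact: w_ge0 | apply: mulr_ge0].
apply: le_trans (ler_wpM2l P0 bd) _.
by rewrite le_eqVlt; apply/orP; left; apply/eqP; rewrite /g; field.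
Qed.

End Distance.

(** * From cutoffs, form convergence and truncated weights to the hypotheses and conclusion of the
    theorem *)

Section Weight.
Context {R : realType} {X : countType}.
Variables (m : X -> R) (b d : X -> X -> R) (q w : X -> R) (lambda : R).
Variables (k : seq X) (u : X -> R) (o : X).

Lemma approximable_le1 (phi : nat -> X -> R) :
  (forall n x, 0 <= phi n x <= phi n.+1 x) ->
  (forall x, phi n x @[n --> \oo] --> (1 : R)) ->
  forall n x, 0 <= phi n x <= 1.
Proof.
move=> phi_nd phi1 n x; have /andP[-> _] := phi_nd n x; rewrite /=.
have nd : nondecreasing_seq (phi ^~ x).
  by apply/nondecreasing_seqP => i; case/andP: (phi_nd i x).
have := nondecreasing_cvgn_le nd (cvgP _ (phi1 x)) n.
by rewrite (cvg_lim _ (phi1 x)).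
Qed.

Lemma h_approximates_cvg (phi : nat -> X -> R) : (forall x, 0 < m x) ->
  h_approximates m b q phi u -> forall x, phi n x @[n --> \oo] --> u x.
Proof.
move=> m0 [_ l2 _] x; apply/cvgrPdist_le => e e0.
have e2 : 0 < e ^+ 2 * m x by rewrite mulr_gt0 ?exprn_gt0.
have F0 n y : 0 <= (phi n y - u y) ^+ 2 * m y by rewrite mulr_ge0 ?sqr_ge0 ?ltW.
have [N HN] := esum_cvg0 F0 l2 e2.
exists N => // n /= Nn; have := HN n [:: x] Nn isT; rewrite big_seq1 ler_pM2r//.
rewrite distrC -real_normK ?num_real// => H.
by rewrite -(ler_pXn2r (n := 2))// ?nnegrE// ltW.
Qed.

Lemma h_approximates_cauchy (phi : nat -> X -> R) : (forall x, 0 < m x) ->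
  h_approximates m b q phi u ->
  forall e : R, 0 < e -> exists N, forall i j s,
  (N <= i)%N -> (N <= j)%N -> uniq s ->
  \sum_(x <- s) (phi i x - phi j x) ^+ 2 * m x <= e.
Proof.
move=> m0 [_ l2 _] e e0; have e4 : 0 < e / 4 by rewrite divr_gt0.
have F0 n y : 0 <= (phi n y - u y) ^+ 2 * m y by rewrite mulr_ge0 ?sqr_ge0 ?ltW.
have [N HN] := esum_cvg0 F0 l2 e4.
exists N => i j s Ni Nj us; have Hi := HN i s Ni us; have Hj := HN j s Nj us.
apply: (@le_trans _ _ (\sum_(x <- s) (2 * ((phi i x - u x) ^+ 2 * m x) +
    2 * ((phi j x - u x) ^+ 2 * m x)))); last first.
  by rewrite big_split/= -!mulr_sumr; lra.
apply: ler_sum => x _; rewrite -subr_ge0.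
rewrite (_ : _ - _ = (phi i x + phi j x - 2 * u x) ^+ 2 * m x); last by ring.
by rewrite mulr_ge0 ?sqr_ge0// ltW.
Qed.

(** On a finite list the truncation is inactive once M is large, and the vertices of K, removed by
    [off], add only a finite sum. *)
Lemma ell2_of_truncated (r C : R) (gbar : X -> R) :
  (forall x, 0 < m x) -> (forall x, 0 <= w x) -> uniq k -> 0 <= r ->
  (forall M F, uniq F ->
     \sum_(x <- F) w x *
       (u x * expR (r / 2 * Num.min (rho b d w o x) M) * off k x) ^+ 2 * m x <= C) ->
  ell2 (fun x => expR (r * rho b d w o x) * w x * m x) u.
Proof.
move=> m0 w0 uk r0 trunc.
pose P x := u x ^+ 2 * (expR (r * rho b d w o x) * w x * m x).
have P0 x : 0 <= P x.
  by rewrite mulr_ge0 ?sqr_ge0// mulr_ge0 ?(ltW (m0 x))// mulr_ge0 ?expR_ge0.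
apply: (@esum_lty _ _ _ (C + \sum_(x <- k) P x)) => F uF.
(* A level above every value of rho on F. *)
pose M := \sum_(x <- F) `|rho b d w o x|.
have rM x : x \in F -> Num.min (rho b d w o x) M = rho b d w o x.
  move=> xF; apply/min_idPl; apply: (le_trans (ler_norm _)).
  by rewrite /M (bigD1_seq x)//= lerDl sumr_ge0.
apply: (@le_trans _ _ (\sum_(x <- F)
    (w x * (u x * expR (r / 2 * Num.min (rho b d w o x) M) * off k x) ^+ 2 * m x +
     (x \in k)%:R * P x))).
  rewrite big_seq [leRHS]big_seq; apply: ler_sum => x xF; rewrite rM// /off /P.
  have -> : expR (r * rho b d w o x) = expR (r / 2 * rho b d w o x) ^+ 2.
    by rewrite -expRM_natl; congr expR; field.
  by case: (x \in k) => /=; rewrite le_eqVlt; apply/orP; left; apply/eqP; ring.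
rewrite big_split/= lerD ?trunc//.
have kP : supp_in k (fun x => (x \in k)%:R * P x).
  by move=> x /negbTE ->; rewrite mul0r.
apply: (le_trans (sum_le_supp uF uk _ kP)) => [x|]; first by rewrite mulr_ge0 ?ler0n.
by rewrite big_seq [leRHS]big_seq; apply: ler_sum => x ->; rewrite mul1r.
Qed.

End Weight.

(** * Exponential decay in both cases, with the range of r *)

Theorem theorem4p1 (R : realType) (X : countType)
    (m : X -> R) (b d : X -> X -> R) (q w : X -> R) (lambda : R)
    (K : set X) (u : X -> R) (o : X)
    (X_infinite : infinite_set [set: X])
    (m_gt0 : forall x, 0 < m x)
    (b_graph : is_graph b)
    (b_lf : locally_finite b)
    (b_conn : graph_connected b)
    (h_bounded : bounded_from_below m b q)
    (d_intrinsic : is_intrinsic_metric m b d)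
    (w_ge0 : forall x, 0 <= w x)
    (K_finite : finite_set K)
    (h_ge_w : form_ge m b q lambda w (~` K))
    (u_cases :
      (approximable m b u /\
        ((forall x, ~ K x -> formalH m b q u x - lambda * u x = 0) \/
         (forall x, ~ K x ->
            0 <= u x /\ formalH m b q u x - lambda * u x <= 0)))
      \/
      [/\ classV m b q, operator_domain m b q u &
          forall x, ~ K x -> formalH m b q u x - lambda * u x = 0]) :
  (exists r : R, 0 < r /\
     ell2 (fun x => expR (r * rho b d w o x) * w x * m x) u) /\
  (forall r : R, 0 < r -> r ^+ 2 * ((1 + expR r) / 16) < 1 ->
     ell2 (fun x => expR (r * rho b d w o x) * w x * m x) u).
Proof.
suff main r : 0 < r -> r ^+ 2 * ((1 + expR r) / 16) < 1 ->
     ell2 (fun x => expR (r * rho b d w o x) * w x * m x) u.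
  split; last exact: main.
  (* For r = 1/2, e^(-1/2) >= 1/2 gives e^r <= 2, so the constant is at most 3/64. *)
  exists 2^-1; split; first by rewrite invr_gt0.
  apply: main; first by rewrite invr_gt0.
  have e1 : 2^-1 <= expR (- 2^-1) :> R.
    by apply: le_trans (expR_ge1Dx _); lra.
  have e2 : expR (2^-1) <= 2 :> R.
    have := expRxMexpNx_1 (2^-1 : R).
    have := ler_wpM2l (expR_ge0 (2^-1 : R)) e1; lra.
  by lra.
move=> r0 rc.
have [k uk kK] := finite_set_seq K_finite.
have KE : K = [set` k] by apply/seteqP; split=> x /kK.
have nK x : x \notin k -> ~ K x by move=> /negP xk /kK.
rewrite KE in h_ge_w.
have [t ht] := hull_exists k b_lf.
pose c := r ^+ 2 * ((1 + expR r) / 16).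
have c01 : 0 <= c < 1.
  by rewrite rc andbT mulr_ge0 ?sqr_ge0// divr_ge0// addr_ge0 ?expR_ge0.
(* The untruncated weight dominates all truncations, so the boundary term is independent of M. *)
pose gbar x := expR (r / 2 * rho b d w o x).
have gbar1 x : 1 <= gbar x.
  by rewrite -expR0 ler_expR mulr_ge0 ?divr_ge0 ?(ltW r0)//
    (rho_ge0 w o b_conn d_intrinsic).
have adm M := admissible_expR_rho o b_graph b_conn d_intrinsic w_ge0 M (ltW r0).
have c1 : 0 < 1 - c by case/andP: c01; rewrite subr_gt0.
apply: (@ell2_of_truncated _ _ m b d w k u o r ((1 - c)^-1 * boundary b k t gbar u)) => //.
  exact: ltW.
move=> M F uF; rewrite ler_pdivlMl//.
case: u_cases => [[[_ [phi [phiC phi_nd phi1 phiE]]] sol]|[qV [[phi aphi] _] sol]].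
- apply: (agmon_subsolution m_gt0 b_graph b_lf w_ge0 ht h_ge_w c01 (adm M) _ phiC
    (approximable_le1 phi_nd phi1) phi1 _ uF).
    (* Both alternatives of (a) give u (H - lambda) u <= 0 off K. *)
    move=> x /nK xK; case: sol => [/(_ x xK) ->|/(_ x xK) [u0 Hu]].
      by rewrite mulr0.
    exact: mulr_ge0_le0.
  move=> e e0; apply: (esum_cvg0 _ phiE e0) => n x.
  rewrite -mulrA mulr_ge0 ?sqr_ge0//.
  (* The empty list yields nonnegativity of the gradient term. *)
  have := sum_grad2_le (s := [::]) m_gt0 b_graph (phi n) x b_lf isT.
  by rewrite big_nil mulr0.
- have [phiC _ phi_form] := aphi.
  apply: (agmon_form_domain m_gt0 b_graph b_lf w_ge0 ht h_ge_w phiC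
    (h_approximates_cvg m_gt0 aphi) (h_approximates_cauchy m_gt0 aphi)
    phi_form h_bounded qV _ gbar1 c01 (adm M) uF).
  by move=> x /nK; exact: sol.
Qed.
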